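(* Let $F=F(N,\mathcal D)$ be a connected generalized Sierpiński carpet. Then $F$ has a cut point if and only if $\chi(\Gamma_k)\ge |\mathcal D|^{k-1}-1$ for all integers $k\ge 2$.
   Context: Let $N\ge 2$ and let $\mathcal D\subset\{0,1,\dots,N-1\}^2$ with $1<|\mathcal D|<N^2$. For $i\in\{0,\dots,N-1\}^2$ let $\varphi_i(x)=\frac1N(x+i)$ on $\mathbb R^2$. The generalized Sierpiński carpet (GSC) $F=F(N,\mathcal D)$ is the unique nonempty compact set with $F=\bigcup_{i\in\mathcal D}\varphi_i(F)$. For $k\ge1$, $\mathcal D^k$ is the set of words $i_1\cdots i_k$ with $i_j\in\mathcal D$, and $\varphi_{i_1\cdots i_k}=\varphi_{i_1}\circ\cdots\circ\varphi_{i_k}$. The $k$-th Hata graph $\Gamma_k$ has vertex set $\mathcal D^k$, with an edge between distinct $\mathbf i,\mathbf j$ iff $\varphi_{\mathbf i}(F)\cap\varphi_{\mathbf j}(F)\neq\varnothing$. For a connected graph $G$, a vertex $v$ is a cut vertex if $G-\{v\}$ (delete $v$ and its incident edges) is disconnected; if $G_1(v),\dots,G_m(v)$ are the components of $G-\{v\}$ ordered so that $|G_1(v)|\ge|G_2(v)|\ge\cdots$ (number of vertices), set $\chi(G)=\max\{|G_2(v)|: v \text{ a cut vertex}\}$, and $\chi(G)=0$ if $G$ has no cut vertex. A cut point of a connected space $X$ is a point $x$ with $X\setminus\{x\}$ disconnected. *)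

(* Defs.v *)
From HB Require Import structures.
From mathcomp Require Import all_boot all_order all_algebra.
From mathcomp Require Import all_classical all_reals all_analysis.
Set Implicit Arguments. Unset Strict Implicit. Unset Printing Implicit Defensive.
Import Order.TTheory GRing.Theory Num.Theory.
Import numFieldNormedType.Exports.

Section Graphs.
Variable T : finType.

Definition restr_rel (S : {set T}) (e : rel T) : rel T :=
  [rel x y | [&& x \in S, y \in S & e x y]].

Definition component (S : {set T}) (e : rel T) (x : T) : {set T} :=
  [set y in S | connect (restr_rel S e) x y].

Definition components (S : {set T}) (e : rel T) : {set {set T}} :=
  [set component S e x | x in S].

Definition cut_vertex (V : {set T}) (e : rel T) (v : T) : bool :=
  (v \in V) && (1 < #|components (V :\ v) e|)%N.

Definition second_comp_size (V : {set T}) (e : rel T) (v : T) : nat :=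
  nth 0%N (sort geq [seq #|C| | C : {set T} in components (V :\ v) e]) 1.

Definition chi (V : {set T}) (e : rel T) : nat :=
  (\max_(v in V | cut_vertex V e v) second_comp_size V e v)%N.
End Graphs.

Local Open Scope classical_set_scope.
Local Open Scope ring_scope.
Section GSC.
Variable R : realType.
Variable N : nat.

Definition digit := ('I_N * 'I_N)%type.

Definition phi (i : digit) (x : R * R) : R * R :=
  ((x.1 + (i.1 : nat)%:R) / N%:R, (x.2 + (i.2 : nat)%:R) / N%:R).

Definition phiw (w : seq digit) : R * R -> R * R :=
  foldr (fun i f => phi i \o f) id w.

Definition is_GSC (D : {set digit}) (F : set (R * R)) : Prop :=
  compact F /\ F !=set0 /\ F = \bigcup_(i in [set i | i \in D]) (phi i @` F).

Definition words (D : {set digit}) (k : nat) : {set k.-tuple digit} :=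
  [set w : k.-tuple digit | all (fun i => i \in D) w].

Definition hata_rel (F : set (R * R)) (k : nat) : rel (k.-tuple digit) :=
  fun w u => (w != u) &&
    `[< (phiw w @` F) `&` (phiw u @` F) !=set0 >].

Definition cut_point (X : set (R * R)) (x : R * R) : Prop :=
  X x /\ ~ connected (X `\ x).
End GSC.
Arguments hata_rel {R N} F k.
Arguments words {N} D k.

(* Main.v *)
Require Import Defs.
From HB Require Import structures.
From mathcomp Require Import all_boot all_order all_algebra.
From mathcomp Require Import all_classical all_reals all_analysis.
From mathcomp Require Import zify ring lra.
Set Implicit Arguments. Unset Strict Implicit. Unset Printing Implicit Defensive.
Import Order.TTheory GRing.Theory Num.Theory.
Import numFieldNormedType.Exports.

(** If the Hata graphs have long tails, remove a cut vertex [v_k] at each level [k]. Along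
    an ultrafilter the cells of [v_k] shrink to a point [x], and the two large components of
    the graph without [v_k] converge to a separation of [F] without [x]: near a point [y] of
    [F] other than [x] all cells through [y] lie on the same side since they meet at [y], and
    both limits are nonempty because only four cells of level 4 contain [x].

    Conversely let [x] be a cut point with sides [A] and [B]; every cell that misses [x] lies
    in [A] or in [B].

    - If the digits split into two classes whose cells have only [x] in common (a pinch
      point), delete a cell of level [k] at [x]. The only delicate case is that of a class
      [{i}] facing two cells at [x], or two digits in all; then [x] is a corner of the cell of
      [i], and deleting the corner cell of level [k - 1] leaves a connected set of
      [#|D| ^ (k - 1) - 1] cells.

    - Without pinch points one may assume that [x] lies in a single cell at each level, so the
      cells of [x] are cut vertices. Their tails are long unless at every scale one of the
      two sides lies in the single first-level cell of [x]. Both sides reach the outside, so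
      the roles alternate: cells [r], [v], [v'] occur such that [r] meets its neighbours inside
      its subcell [v] only and [v] meets its neighbours inside its subcell [v'] only. Comparing
      the contacts on opposite edges of the square forces [v] and [v'] to be opposite digits
      that are end vertices of the first Hata graph, and then a cut point of the cell next to
      such an end vertex separates it from the rest. *)

(** * Components of finite graphs and the number [chi] *)

Lemma sort_geq_nth1 (s : seq nat) (m : nat) :
  (2 <= count (leq m) s)%N -> (m <= nth 0 (sort geq s) 1)%N.
Proof.
move=> h; have srt: sorted geq (sort geq s) by apply: sort_sorted => a b; exact: leq_total.
move: h; rewrite -(permP (permEl (perm_sort geq s))).
case: (sort geq s) srt => [|a [|b t]] //= srt.
- by case: (m <= a)%N.
case/andP: srt => _ srt.
case: (leqP m b) => // ltb.
have : all (fun x => ~~ (m <= x)%N) t.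
  apply/allP => x xt; rewrite -ltnNge.
  have tr: transitive geq by move=> p q r /= h1 h2; apply: leq_trans h2 h1.
  have /allP/(_ _ xt) /= h := order_path_min tr srt.
  exact: leq_ltn_trans h ltb.
rewrite all_predC has_count -leqNgt leqn0 => /eqP ->.
by case: (m <= a)%N.
Qed.

(** Positivity of [m] excludes lists with fewer than two entries, on which [nth] returns its default
    value 0. *)
Lemma nth1_sort_geq (s : seq nat) (m : nat) : (0 < m)%N ->
  (m <= nth 0 (sort geq s) 1)%N -> (2 <= count (leq m) s)%N.
Proof.
move=> m0; have srt: sorted geq (sort geq s) by apply: sort_sorted => a b; exact: leq_total.
rewrite -(permP (permEl (perm_sort geq s))).
case: (sort geq s) srt => [|a [|b t]] //=; try by rewrite leqn0; case: m m0.
case/andP=> ab _ mb; rewrite mb (leq_trans mb ab); lia.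
Qed.

Section Components.
Variables (T : finType) (e : rel T).
Implicit Types (S V P : {set T}) (v x y : T).

Lemma connect_stable S P x y :
  (forall a b, a \in P -> restr_rel S e a b -> b \in P) ->
  x \in P -> connect (restr_rel S e) x y -> y \in P.
Proof.
move=> PS xP /connectP[p]; elim: p x xP => [|z p IH] x xP /=; first by move=> _ ->.
by case/andP => exz; apply: IH; apply: PS exz.
Qed.

(** Each of [S1] and [S2] lies in one component, and [P], being closed under edges, keeps these
    components apart; so the second largest component has at least [m] vertices. *)
Lemma chi_ge V v m S1 S2 P : (0 < m)%N -> v \in V ->
  S1 \subset V :\ v -> S2 \subset V :\ v ->
  {in S1 &, forall x y, connect (restr_rel (V :\ v) e) x y} ->
  {in S2 &, forall x y, connect (restr_rel (V :\ v) e) x y} ->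
  (forall a b, a \in P -> restr_rel (V :\ v) e a b -> b \in P) ->
  S1 \subset P -> [disjoint S2 & P] ->
  (m <= #|S1|)%N -> (m <= #|S2|)%N -> (m <= chi V e)%N.
Proof.
move=> m0 vV s1 s2 c1 c2 PP s1P s2P m1 m2.
have [x1 x1S] : exists x, x \in S1 by apply/set0Pn; rewrite -card_gt0; apply: leq_trans m1.
have [x2 x2S] : exists x, x \in S2 by apply/set0Pn; rewrite -card_gt0; apply: leq_trans m2.
pose C1 := component (V :\ v) e x1; pose C2 := component (V :\ v) e x2.
have C1c : C1 \in components (V :\ v) e by apply: imset_f; apply: (fintype.subsetP s1).
have C2c : C2 \in components (V :\ v) e by apply: imset_f; apply: (fintype.subsetP s2).
have S1C : S1 \subset C1.
  by apply/fintype.subsetP => y yS; rewrite inE (fintype.subsetP s1) //= c1.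
have S2C : S2 \subset C2.
  by apply/fintype.subsetP => y yS; rewrite inE (fintype.subsetP s2) //= c2.
have C12 : C1 != C2.
  apply/eqP => C12.
  have : x2 \in C1 by rewrite C12 (fintype.subsetP S2C).
  rewrite inE => /andP[_ cc].
  have := connect_stable PP (fintype.subsetP s1P _ x1S) cc.
  by rewrite (disjointFr s2P).
have cv : cut_vertex V e v.
  rewrite /cut_vertex vV /=.
  have /subset_leq_card : [set C1; C2] \subset components (V :\ v) e.
    by apply/fintype.subsetP => C; rewrite !inE => /orP[]/eqP->.
  by rewrite cards2 C12.
apply: (@leq_trans (second_comp_size V e v)); last first.
  by apply: (@leq_bigmax_cond _ _ (second_comp_size V e)); rewrite vV cv.
apply: sort_geq_nth1.
rewrite count_map -size_filter.
have /uniq_leq_size : uniq [:: C1; C2] by rewrite /= inE C12.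
apply=> C; rewrite !inE mem_filter mem_enum => /orP[]/eqP-> /=.
  by rewrite C1c andbT (leq_trans m1) // subset_leq_card.
by rewrite C2c andbT (leq_trans m2) // subset_leq_card.
Qed.

Lemma chi_witness V m : (0 < m)%N -> (m <= chi V e)%N ->
  exists v x1 x2, [/\ v \in V, x1 \in V :\ v, x2 \in V :\ v,
    ~~ connect (restr_rel (V :\ v) e) x1 x2 &
    (m <= #|component (V :\ v) e x1|)%N /\ (m <= #|component (V :\ v) e x2|)%N].
Proof.
move=> m0 mchi.
have [v /andP[vV cv] mv] : exists2 v, (v \in V) && cut_vertex V e v &
   (m <= second_comp_size V e v)%N.
  case: (pickP [pred v | (v \in V) && cut_vertex V e v && (m <= second_comp_size V e v)%N]).
    by move=> v /andP[vv mm]; exists v.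
  move=> nov; exfalso; move: mchi; rewrite leqNgt => /negP; apply.
  rewrite /chi; elim/big_rec: _ => // v r vv; rewrite gtn_max => ->.
  by rewrite andbT ltnNge; move: (nov v) => /=; rewrite vv /= => ->.
have := nth1_sort_geq m0 mv; rewrite count_map -size_filter.
set s := seq.filter _ _ => hs.
have us : uniq s by apply: filter_uniq; apply: enum_uniq.
have memS C : C \in s -> C \in components (V :\ v) e /\ (m <= #|C|)%N.
  by rewrite mem_filter mem_enum => /andP[].
case: s us hs memS => [|C1 [|C2 s]] //= us _ memS.
have [/imsetP[x1 x1V E1] h1] := memS C1 (mem_head _ _).
have [/imsetP[x2 x2V E2] h2] : C2 \in components (V :\ v) e /\ (m <= #|C2|)%N.
  by apply: memS; rewrite !inE eqxx orbT.
have C12 : C1 != C2 by case/andP: us; rewrite inE negb_or => /andP[].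
(* [e] is not assumed symmetric, so both directions are tried; if [x1] and [x2] reached each other,
   their components would coincide. *)
exists v; have [x12|x12] := boolP (connect (restr_rel (V :\ v) e) x1 x2); last first.
  by exists x1, x2; split => //; rewrite -E1 -E2.
have [x21|x21] := boolP (connect (restr_rel (V :\ v) e) x2 x1); last first.
  by exists x2, x1; split => //; rewrite -E1 -E2.
case/negP: C12; rewrite E1 E2; apply/eqP/setP => y; rewrite !inE.
by congr andb; apply/idP/idP; apply: connect_trans.
Qed.
End Components.

Local Open Scope classical_set_scope.
Local Open Scope ring_scope.

(** * Planar digit arguments *)

Section RealDigits.
Variables (R : realType) (N : nat).
Hypothesis N2 : (2 <= N)%N.

Lemma natN_ge2 : 2 <= N%:R :> R. Proof. by rewrite ler_nat. Qed.

Lemma natN_gt0 : 0 < N%:R :> R. Proof. by rewrite ltr0n; lia. Qed.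

Lemma natN_neq0 : N%:R != 0 :> R. Proof. by rewrite lt0r_neq0 ?natN_gt0. Qed.

Lemma natN1_neq0 : N%:R - 1 != 0 :> R.
Proof. by rewrite subr_eq0 pnatr_eq1; lia. Qed.

(** The Archimedean property, as [N ^ k > k]. It turns a bound valid at every level of cells into an
    inequality between coordinates. *)
Lemma bounded_exp_le0 (a M : R) : (forall k, a * N%:R ^+ k <= M) -> a <= 0.
Proof.
move=> h; case: (leP a 0) => // a0; exfalso.
pose k := Num.bound (`|M| / a).
have kb : `|M| / a < k%:R by apply: archi_boundP; rewrite divr_ge0 // ltW.
have : a * k%:R <= M.
  apply: le_trans (h k); rewrite ler_pM2l // -natrX ler_nat ltnW //.
  by apply: ltn_expl; lia.
rewrite ltr_pdivrMr // in kb; have := ler_norm M; lra.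
Qed.

(* The step [b |-> N * b - c] multiplies the difference of two points by [N]. *)
Lemma expansion_eq (S : R -> Prop) (c : R) : (forall b, S b -> 0 <= b <= 1) ->
  (forall b, S b -> S (N%:R * b - c)) -> forall b b', S b -> S b' -> b = b'.
Proof.
move=> S01 SN.
suff h b b' : S b -> S b' -> b - b' <= 0.
  by move=> b b' Sb Sb'; apply/le_anti; rewrite -subr_le0 h //= -subr_le0 h.
move=> Sb Sb'; apply: (@bounded_exp_le0 _ 1) => k.
elim: k b b' Sb Sb' => [|k IH] b b' Sb Sb'.
  by rewrite expr0; have := S01 _ Sb; have := S01 _ Sb'; lra.
have := IH _ _ (SN _ Sb) (SN _ Sb').
by rewrite exprSr; congr (_ <= _); ring.
Qed.

(** One-coordinate form of the contact of two cells of equal level; later case distinctions on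
    contacts apply it along each axis. *)
Lemma touch1 (a a' : R) (i j : nat) : 0 <= a <= 1 -> 0 <= a' <= 1 ->
  a + i%:R = a' + j%:R ->
  [\/ i = j /\ a = a', [/\ i = j.+1, a = 0 & a' = 1] | [/\ j = i.+1, a = 1 & a' = 0]].
Proof.
move=> ha ha' e.
move: e; have [ij|ij|->] := ltngtP i j => e; last by constructor 1; split => //; lra.
- have : (i.+1%:R : R) <= j%:R by rewrite ler_nat.
  rewrite -natr1 => h; constructor 3; split; [|lra|lra].
  apply/eqP; rewrite eqn_leq ij andbT -(ler_nat R) -natr1; lra.
- have : (j.+1%:R : R) <= i%:R by rewrite ler_nat.
  rewrite -natr1 => h; constructor 2; split; [|lra|lra].
  apply/eqP; rewrite eqn_leq ij andbT -(ler_nat R) -natr1; lra.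
Qed.

Lemma digit_eq0 (i : nat) (a : R) : 0 <= a -> a + i%:R = 0 -> i = 0%N /\ a = 0.
Proof.
move=> a0 e; have i0 : 0 <= i%:R :> R by rewrite ler0n.
by split; [apply/eqP; rewrite -(eqr_nat R); apply/eqP; rewrite mulr0n|]; lra.
Qed.

Lemma digit_eqN (i : nat) (a : R) : a <= 1 -> (i < N)%N -> a + i%:R = N%:R ->
  i = N.-1 /\ a = 1.
Proof.
move=> a0 iN e; have i0 : (i.+1%:R : R) <= N%:R by rewrite ler_nat.
rewrite -natr1 in i0; split; last by lra.
suff : i.+1 = N by lia.
apply/eqP; rewrite eqn_leq iN -(ler_nat R) -natr1; lra.
Qed.

Lemma natrB1 : N.-1%:R = N%:R - 1 :> R.
Proof. have e : N = N.-1.+1 by lia. by rewrite [in RHS]e -natr1 addrK. Qed.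

(** The number [j / (N - 1)] has the base [N] expansion [0.jjj...] and no other one. *)
Lemma fixpoint_digit (i j : nat) (a : R) : (j < N)%N -> (i < N)%N -> 0 <= a <= 1 ->
  N%:R * (j%:R / (N%:R - 1)) = a + i%:R -> i = j.
Proof.
move=> jN iN a01 e; have n2 := natN_ge2.
set b := j%:R / (N%:R - 1) in e.
have b01 : 0 <= b <= 1.
  rewrite /b divr_ge0 ?ler0n //=; last by rewrite subr_ge0; lra.
  rewrite ler_pdivrMr ?mul1r; last by lra.
  by rewrite -natrB1 ler_nat; lia.
have bE : b * (N%:R - 1) = j%:R by rewrite /b divfK ?natN1_neq0.
have : b + j%:R = a + i%:R by lra.
case/(touch1 b01 a01) => [[-> //]|[ji b0 _]|[ij b1 _]]; exfalso.
  by move: bE; rewrite b0 mul0r ji => /esym/eqP; rewrite pnatr_eq0.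
move: bE; rewrite b1 mul1r -natrB1 => /eqP; rewrite eqr_nat => /eqP; lia.
Qed.
End RealDigits.

Section Planar.
(** [Fr] and [Dg] stand for the carpet and its digit set read in two coordinates. They are abstract
    predicates so that any choice of axes and reflections can be substituted. *)
Variables (R : realType) (N : nat) (Fr : R -> R -> Prop) (Dg : nat -> nat -> Prop).
Hypothesis N2 : (2 <= N)%N.
Hypothesis Dlt : forall i j, Dg i j -> (i < N)%N /\ (j < N)%N.
Hypothesis F01 : forall a b, Fr a b -> 0 <= a <= 1 /\ 0 <= b <= 1.
Hypothesis Fout : forall i j a b, Dg i j -> Fr a b ->
  Fr ((a + i%:R) / N%:R) ((b + j%:R) / N%:R).
Hypothesis Fin : forall a b, Fr a b ->
  exists i j, Dg i j /\ Fr (N%:R * a - i%:R) (N%:R * b - j%:R).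
Hypothesis Ffix : forall i j, Dg i j ->
  Fr (i%:R / (N%:R - 1)) (j%:R / (N%:R - 1)).

(* Horizontally (resp. vertically) adjacent cells meet exactly at the points of their
   common edge with relative position in [Lk] (resp. [Vk]). *)
Definition Lk y := Fr 0 y /\ Fr 1 y.
Definition Vk x := Fr x 0 /\ Fr x 1.

Let n2 : 2 <= N%:R :> R. Proof. exact: natN_ge2. Qed.

Lemma Fr0x y : Fr 0 y -> exists j, Dg 0 j /\ Fr 0 (N%:R * y - j%:R).
Proof.
move=> h; have [i [j [dij f]]] := Fin h.
have [a01 _] := F01 f.
have e : (N%:R * 0 - i%:R) + i%:R = 0 :> R by rewrite subrK mulr0.
have [i0 _] := digit_eq0 (proj1 (andP a01)) e.
by exists j; move: f dij; rewrite i0 mulr0 subr0.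
Qed.

Lemma Fr1x y : Fr 1 y -> exists j, Dg N.-1 j /\ Fr 1 (N%:R * y - j%:R).
Proof.
move=> h; have [i [j [dij f]]] := Fin h.
have [a01 _] := F01 f; have [iN _] := Dlt dij.
have e : (N%:R * 1 - i%:R) + i%:R = N%:R :> R by rewrite subrK mulr1.
have [i0 e1] := digit_eqN N2 (proj2 (andP a01)) iN e.
by exists j; move: f dij; rewrite e1 i0.
Qed.

Lemma Frx1 y : Fr y 1 -> exists j, Dg j N.-1 /\ Fr (N%:R * y - j%:R) 1.
Proof.
move=> h; have [j [i [dij f]]] := Fin h.
have [_ a01] := F01 f; have [_ iN] := Dlt dij.
have e : (N%:R * 1 - i%:R) + i%:R = N%:R :> R by rewrite subrK mulr1.
have [i0 e1] := digit_eqN N2 (proj2 (andP a01)) iN e.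
by exists j; move: f dij; rewrite e1 i0.
Qed.

Lemma Dg11 : Fr 1 1 -> Dg N.-1 N.-1.
Proof.
case/Fr1x => j [dj f]; have [_ jN] := Dlt dj; have [_ b01] := F01 f.
have e : (N%:R * 1 - j%:R) + j%:R = N%:R :> R by rewrite subrK mulr1.
by move: dj; have [-> _] := digit_eqN N2 (proj2 (andP b01)) jN e.
Qed.

Lemma Dg10 : Fr 1 0 -> Dg N.-1 0.
Proof.
case/Fr1x => j [dj f]; have [_ b01] := F01 f.
have e : (N%:R * 0 - j%:R) + j%:R = 0 :> R by rewrite subrK mulr0.
by move: dj; have [-> _] := digit_eq0 (proj1 (andP b01)) e.
Qed.

Lemma Dg00 : Fr 0 0 -> Dg 0 0.
Proof.
case/Fr0x => j [dj f]; have [_ b01] := F01 f.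
have e : (N%:R * 0 - j%:R) + j%:R = 0 :> R by rewrite subrK mulr0.
by move: dj; have [-> _] := digit_eq0 (proj1 (andP b01)) e.
Qed.

Lemma divN1 : N.-1%:R / (N%:R - 1) = 1 :> R.
Proof. by rewrite natrB1 // divff ?natN1_neq0. Qed.

Lemma divN : (1 + N.-1%:R) / N%:R = 1 :> R.
Proof. by rewrite natrB1 // addrC subrK divff ?natN_neq0. Qed.

Lemma Fr10 : Dg N.-1 0 -> Fr 1 0.
Proof. by move/Ffix; rewrite divN1 mul0r. Qed.
Lemma Fr01 : Dg 0 N.-1 -> Fr 0 1.
Proof. by move/Ffix; rewrite divN1 mul0r. Qed.
Lemma Fr11 : Dg N.-1 N.-1 -> Fr 1 1.
Proof. by move/Ffix; rewrite divN1. Qed.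

(** Of the two end points of a contact at height [y], the left one lies in row [rho] and the right
    one in some row [j]. Either the rows agree and the contact descends to them, or they are
    adjacent and [y] is the height of their common boundary. *)
Lemma Lk_row y rho : Fr 0 (N%:R * y - rho%:R) -> Fr 1 y ->
  [\/ Dg N.-1 rho /\ Lk (N%:R * y - rho%:R),
      exists j, [/\ rho = j.+1, Dg N.-1 j, Fr 0 0, Fr 1 1 & N%:R * y = rho%:R]
    | [/\ Dg N.-1 rho.+1, Fr 0 1, Fr 1 0 & N%:R * y = rho.+1%:R]].
Proof.
move=> h0 /Fr1x[j [dj h1]]; have [_ a01] := F01 h0; have [_ b01] := F01 h1.
have : (N%:R * y - rho%:R) + rho%:R = (N%:R * y - j%:R) + j%:R by rewrite !subrK.
case/(touch1 a01 b01) => [[e _]|[e ea eb]|[e ea eb]].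
- by constructor 1; rewrite e in h0 *.
- rewrite ea in h0; rewrite eb in h1.
  by constructor 2; exists j; split => //; lra.
- rewrite ea in h0; rewrite eb in h1.
  by constructor 3; rewrite -e; split => //; rewrite e -natr1; lra.
Qed.

Lemma Vk_col x sg : Fr (N%:R * x - sg%:R) 0 -> Fr x 1 ->
  [\/ Vk (N%:R * x - sg%:R),
      exists j, [/\ sg = j.+1, Fr 0 0 & Fr 1 1] | Fr 1 0 /\ Fr 0 1].
Proof.
move=> h0 /Frx1[j [dj h1]]; have [a01 _] := F01 h0; have [b01 _] := F01 h1.
have : (N%:R * x - sg%:R) + sg%:R = (N%:R * x - j%:R) + j%:R by rewrite !subrK.
case/(touch1 a01 b01) => [[e _]|[e ea eb]|[e ea eb]].
- by constructor 1; rewrite e in h0 *.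
- rewrite ea in h0; rewrite eb in h1; by constructor 2; exists j.
- by rewrite ea in h0; rewrite eb in h1; constructor 3.
Qed.

(** If the opposite digit were missing, every contact would be at a corner of the subcell
    [(0, rho)]. For an inner row two different contacts use both corners, so [(0, 0)] and [(1, 0)]
    belong to the carpet, and 0 is a contact outside the subcell. For an extreme row the corner
    itself yields the digit. *)
Lemma opposite_digit rho y0 : Dg 0 rho ->
  (forall y, Lk y -> Fr 0 (N%:R * y - rho%:R)) -> Lk y0 ->
  ((0 < rho < N.-1)%N -> exists y y', [/\ Lk y, Lk y' & y <> y']) ->
  Dg N.-1 rho.
Proof.
move=> drho hL Ly0 h2; have [_ rhoN] := Dlt drho.
have no00 : (0 < rho)%N -> Fr 0 0 -> Fr 1 0 -> False.
  move=> r0 f0 f1; have [_] := F01 (hL 0 (conj f0 f1)).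
  have : 1%:R <= rho%:R :> R by rewrite ler_nat.
  lra.
have mid : (0 < rho < N.-1)%N -> Dg N.-1 rho.
  move=> /[dup] hr /andP[r0 _].
  have [y [y' [Ly Ly' ne]]] := h2 hr.
  have [[//]|[j [_ _ f00 _ ey]]|[_ _ f10 ey]] := Lk_row (hL _ Ly) Ly.2;
  have [[//]|[j' [_ _ f00' _ ey']]|[_ _ f10' ey']] := Lk_row (hL _ Ly') Ly'.2.
  - by case: ne; apply: (@mulfI _ N%:R); [exact: natN_neq0|rewrite ey ey'].
  - by case: (no00 r0).
  - by case: (no00 r0).
  - by case: ne; apply: (@mulfI _ N%:R); [exact: natN_neq0|rewrite ey ey'].
have [r0|r0] := posnP rho.
  have [[//]|[j [e _ _ _ _]]|[_ _ f10 _]] := Lk_row (hL _ Ly0) Ly0.2.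
    by rewrite e in r0.
  by rewrite r0; apply: Dg10.
have [rN|rN] := ltnP rho N.-1; first by apply: mid; rewrite r0.
have [[//]|[j [e _ _ f11 _]]|[d _ _ _]] := Lk_row (hL _ Ly0) Ly0.2.
  have -> : rho = N.-1 by lia.
  exact: Dg11.
have [_] := Dlt d; lia.
Qed.

(* [(0, rho + 1)] catches all contacts of a cell with a left neighbour, [(sg, 0)] all
   contacts with a lower neighbour, and the first of these two digits has a lower
   neighbour itself: impossible. *)
Lemma no_corner_turn rho sg : Dg 0 rho.+1 -> Dg N.-1 rho.+1 -> Dg 0 rho ->
  (forall y, Lk y -> Fr 0 (N%:R * y - rho.+1%:R)) ->
  ((rho.+1 < N.-1)%N -> exists y y', [/\ Lk y, Lk y' & y <> y']) ->
  Dg sg 0 -> Dg sg N.-1 ->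
  (forall x, Vk x -> Fr (N%:R * x - sg%:R) 0) ->
  ((sg < N.-1)%N -> exists x x', [/\ Vk x, Vk x' & x <> x']) -> False.
Proof.
move=> d0 d1 dm hL h2L s0 s1 hV h2V.
have rN : (rho.+1 < N)%N by case: (Dlt d0).
have sN : (sg < N)%N by case: (Dlt s0).
have nL0 : ~ Lk 0.
  move=> /hL/F01[_]; have : 1%:R <= rho.+1%:R :> R by rewrite ler_nat.
  lra.
(* Otherwise [(rho + 1) / N] would be a contact, at the lower corner of the subcell [(0, rho + 1)];
   this puts [(0, 0)] in the carpet and makes 0 a contact. *)
have n0110 : Fr 0 1 -> Fr 1 0 -> False.
  move=> f01 f10.
  have := Fout dm f01; have := Fout d1 f10.
  rewrite divN !add0r mul0r nat1r.
  move=> l1 l0; have /hL := conj l0 l1.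
  rewrite mulrC divfK ?subrr => [f00|]; last by apply: natN_neq0.
  by apply: nL0.
(* The fixed points of [(0, rho)] and [(N - 1, rho)] would form a contact in row [rho], outside row
   [rho + 1]. *)
have nd : ~ Dg N.-1 rho.
  move=> d; have l0 := Ffix dm; have l1 := Ffix d.
  rewrite mul0r in l0; rewrite divN1 in l1.
  have [_ a01] := F01 (hL _ (conj l0 l1)).
  have : N%:R * (rho%:R / (N%:R - 1)) =
    (N%:R * (rho%:R / (N%:R - 1)) - rho.+1%:R) + rho.+1%:R :> R by rewrite subrK.
  move/fixpoint_digit => /(_ N2 (ltnW rN) rN a01); lia.
have row y : Lk y -> ~ Fr 0 0 \/ ~ Fr 1 1 \/ (forall j, rho.+1 = j.+1 -> ~ Dg N.-1 j) ->
    ~ Fr 0 1 \/ ~ Fr 1 0 -> Lk (N%:R * y - rho.+1%:R).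
  move=> Ly a b; have [[_ //]|[j [e dj f00 f11 _]]|[_ f01 f10 _]] := Lk_row (hL _ Ly) Ly.2.
  - by case: a => [//|[//|/(_ _ e)]].
  - by case: b.
(* If the expansion maps contacts to contacts, [expansion_eq] leaves only one contact, against
   [h2L]. *)
have Lcontra : (rho.+1 < N.-1)%N -> (forall y, Lk y -> Lk (N%:R * y - rho.+1%:R)) -> False.
  move=> hr cl; have [y [y' [Ly Ly' ne]]] := h2L hr.
  apply: ne; apply: (expansion_eq N2 _ cl Ly Ly') => b [fb _].
  by case: (F01 fb).
have [es|ns] := eqVneq sg N.-1.
  have f10 : Fr 1 0 by apply: Fr10; rewrite -es.
  have f11 : Fr 1 1 by apply: Fr11; rewrite -{1}es.
  have n01 : ~ Fr 0 1 by move=> f01; apply: n0110.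
  have hr : (rho.+1 < N.-1)%N.
    rewrite ltn_neqAle; apply/andP; split; last by lia.
    by apply/eqP => e; apply: n01; apply: Fr01; rewrite -e.
  apply: (Lcontra hr) => y Ly; apply: row => //; last by left.
  by left=> f00; apply: nL0.
have hs : (sg < N.-1)%N by lia.
have nV1 : ~ Vk 1.
  move=> /hV/F01[a01 _]; have : (sg.+2%:R : R) <= N%:R by rewrite ler_nat; lia.
  rewrite -!natr1; lra.
have [x [x' [Vx Vx' ne]]] := h2V hs.
(* Likewise for vertical contacts: one of them does not descend, and this exception puts [(0, 0)]
   and [(1, 1)] in the carpet. *)
have [clV|] := pselect (forall x, Vk x -> Vk (N%:R * x - sg%:R)).
  apply: ne; apply: (expansion_eq N2 _ clV Vx Vx') => b [fb _].
  by case: (F01 fb).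
move=> /existsNP[z /not_implyP[Vz nVz]].
have [//|[j [e f00 f11]]|[f10 f01]] := Vk_col (hV _ Vz) Vz.2; last by apply: n0110.
have n01 : ~ Fr 0 1.
  move=> f01; have [a01 _] := F01 (hV 0 (conj f00 f01)).
  have : 1%:R <= sg%:R :> R by rewrite ler_nat e.
  lra.
have hr : (rho.+1 < N.-1)%N.
  rewrite ltn_neqAle; apply/andP; split; last by lia.
  by apply/eqP => e1; apply: n01; apply: Fr01; rewrite -e1.
apply: (Lcontra hr) => y Ly; apply: row => //; last by left.
by right; right => j' [<-].
Qed.

Definition Tch (i1 i2 j1 j2 : nat) := exists a b a' b',
  [/\ Fr a b, Fr a' b', a + i1%:R = a' + j1%:R & b + i2%:R = b' + j2%:R].

(** The neighbours of the corner cell are among [(1, 0)], [(0, 1)] and [(1, 1)], and the last two do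
    not both occur: with [Fr 1 1], the digit [(0, 1)] would give a horizontal contact at height 1 or
    [1 / N], against [L0]. The remaining pairs touch at a corner. *)
Lemma corner_neighbours : Fr 0 0 -> Fr 1 0 -> (forall y, Lk y -> y = 0) ->
  ((Fr 0 1 /\ forall x, Vk x -> x = 0) \/ Fr 1 1) ->
  forall i1 i2 j1 j2, Dg i1 i2 -> Dg j1 j2 ->
  (i1, i2) <> (0, 0)%N -> (j1, j2) <> (0, 0)%N ->
  Tch 0 0 i1 i2 -> Tch 0 0 j1 j2 -> (i1, i2) <> (j1, j2) -> Tch i1 i2 j1 j2.
Proof.
move=> f00 f10 L0 hc.
have nb i1 i2 : Dg i1 i2 -> Tch 0 0 i1 i2 -> (i1, i2) <> (0, 0)%N ->
   [\/ (i1, i2) = (1, 0)%N, (i1, i2) = (0, 1)%N /\ ~ Fr 1 1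
     | (i1, i2) = (1, 1)%N /\ Fr 1 1].
  move=> di [a [b [a' [b' [fab fab' e1 e2]]]]] ne.
  have [a01 b01] := F01 fab; have [a01' b01'] := F01 fab'.
  have [] := touch1 a01 a01' e1; case=> e1' ea; try (move=> ea'; move: e1'=> //=e1');
  have [] := touch1 b01 b01' e2; case=> e2' eb; try (move=> eb'; move: e2' => //= e2').
  - by case: ne; rewrite -e1' -e2'.
  - constructor 2; rewrite -e1' e2'; split => // f11.
    case: hc => [[f01 _]|_].
      have := L0 1 (conj f01 f11); lra.
    have dd := Dg10 f10; rewrite -e1' e2' in di.
    have l0 := Fout di f00; have l1 := Fout dd f11.
    rewrite divN addr0 in l1; rewrite !add0r mul0r in l0.
    have /eqP := L0 _ (conj l0 l1); by rewrite mulf_eq0 invr_eq0 oner_eq0 (negPf (natN_neq0 _ N2)).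
  - by constructor 1; rewrite e1' -e2'.
  - constructor 3; rewrite e1' e2'; split => //.
    by move: fab; rewrite ea eb.
have t1001 : Fr 0 1 -> Tch 1 0 0 1.
  by move=> f01; exists 0, 1, 1, 0; split => //; lra.
have t1011 : Fr 1 1 -> Tch 1 0 1 1.
  by move=> f11; exists 1, 1, 1, 0; split => //; lra.
have sym p q p' q' : Tch p q p' q' -> Tch p' q' p q.
  by move=> [a [b [a' [b' [? ? ? ?]]]]]; exists a', b', a, b.
move=> i1 i2 j1 j2 di dj ni nj ti tj ne.
case: (nb _ _ di ti ni) (nb _ _ dj tj nj) ne => [[-> ->]|[[-> ->] h1]|[[-> ->] h1]]
   [[-> ->]|[[-> ->] h2]|[[-> ->] h2]] // ne.
- by apply: t1001; case: hc => [[]|].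
- exact: t1011.
- by apply/sym/t1001; case: hc => [[]|].
- by apply/sym/t1011.
Qed.
End Planar.

(** * Cells and connectedness *)

Section FiniteUnions.
Variables (T : topologicalType) (I : finType) (K : I -> set T).
Implicit Types S P : {set I}.

Definition union S : set T := [set z | exists2 i, i \in S & K i z].

Lemma union_closed S : (forall i, closed (K i)) -> closed (union S).
Proof.
move=> cK; suff -> : union S = \bigcup_(i in [set` S]) K i.
  by apply: closed_bigcup => //; exact: finite_finset.
by apply/seteqP; split=> z [i]; exists i.
Qed.

(** A part [P] without link to its complement would give two disjoint closed sets that cover the
    union. This lemma and the next translate between topological connectedness and the graph of
    intersections. *)
Lemma linked_of_connected S P : (forall i, closed (K i)) -> (forall i, K i !=set0) ->
  connected (union S) -> P \subset S -> P != finset.set0 -> P != S ->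
  exists i j, [/\ i \in P, j \in S, j \notin P & K i `&` K j !=set0].
Proof.
move=> cK nK conS PS P0 PnS; apply: contrapT => no.
have dis z : union P z -> union (S :\: P)%SET z -> False.
  move=> [i iP Ki] [j]; rewrite inE => /andP[jP jS] Kj.
  by apply: no; exists i, j; split=> //; exists z.
have sep : separated (union P) (union (S :\: P)%SET).
  split; rewrite -subset0 => z [].
    by move=> /(union_closed cK) h1 /(dis _ h1).
  by move=> h1 /(union_closed cK) /(dis _ h1).
have sub : union S `<=` union P `|` union (S :\: P)%SET.
  move=> z [i iS Ki]; have [iP|iP] := boolP (i \in P); first by left; exists i.
  by right; exists i => //; rewrite inE iP.
have [h|h] := connected_subset sep sub conS.
  case/negP: PnS; rewrite finset.eqEsubset PS; apply/fintype.subsetP => i iS.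
  apply: contraT => iP; have [z Kz] := nK i.
  have uz : union S z by exists i.
  case: (dis z (h _ uz)); exists i => //; by rewrite inE iP.
case/finset.set0Pn: P0 => i iP; have [z Kz] := nK i.
have uz : union P z by exists i.
case: (dis z uz); apply: h; exists i => //; exact: (fintype.subsetP PS).
Qed.

Lemma connected_of_linked S : (forall i, connected (K i)) -> (forall i, K i !=set0) ->
  (forall P, P \subset S -> P != finset.set0 -> P != S ->
    exists i j, [/\ i \in P, j \in S, j \notin P & K i `&` K j !=set0]) ->
  connected (union S).
Proof.
move=> cK nK lk; apply: contrapT => /connectedPn[E [En SE sep]].
have dis z : E false z -> E true z -> False.
  move=> e0 e1; have [s _] := sep; suff : set0 z by [].
  by rewrite -s; split=> //; apply: subset_closure.
have side i : i \in S -> K i `<=` E false \/ K i `<=` E true.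
  move=> iS; apply: (connected_subset sep _ (cK i)) => z Kz.
  by rewrite -SE; exists i.
pose P : {set I} := [set i in S | `[< K i `<=` E true >]]%SET.
have [] := lk P.
- by apply/fintype.subsetP => i; rewrite inE => /andP[].
- have [z ez] := En true; have : union S z by rewrite SE; right.
  case=> i iS Kz; apply/finset.set0Pn; exists i; rewrite inE iS; apply/asboolP.
  by case: (side i iS) => // h; case: (dis z (h _ Kz)).
- have [z ez] := En false; have : union S z by rewrite SE; left.
  case=> i iS Kz; apply/eqP => PS; move: iS; rewrite -PS inE => /andP[_ /asboolP h].
  by apply: (dis z) => //; exact: h.
move=> i [j [iP jS jP [z [Kiz Kjz]]]]; move: iP; rewrite inE => /andP[_ /asboolP h].
case: (side j jS) => h'; first by apply: (dis z); [apply: h'|apply: h].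
by case/negP: jP; rewrite inE jS; apply/asboolP.
Qed.
End FiniteUnions.

(* A frame is an axis together with a possible reflection of it. Stating the planar
   arguments in an arbitrary pair of frames with different axes takes care of the eight
   symmetries of the square. *)
Definition frame := (bool * bool)%type.

Section Coordinates.
Variables (R : realType) (N : nat).
Hypothesis N2 : (2 <= N)%N.
Implicit Types (f g : frame) (z : R * R) (i : digit N).

Definition co f z : R :=
  let c := if f.1 then z.1 else z.2 in if f.2 then 1 - c else c.
Definition cd f i : nat :=
  let c := if f.1 then i.1 : nat else i.2 : nat in if f.2 then (N.-1 - c)%N else c.
Definition flip f : frame := (f.1, ~~ f.2).

Lemma flipK f : flip (flip f) = f.
Proof. by case: f => a b; rewrite /flip /= negbK. Qed.

Lemma cd_lt f i : (cd f i < N)%N.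
Proof.
have := ltn_ord i.1; have := ltn_ord i.2.
rewrite /cd; case: f.1; case: f.2; lia.
Qed.

Lemma coE f i z : co f (phi i z) = (co f z + (cd f i)%:R) / N%:R.
Proof.
have n0 := natN_neq0 R N2; have := ltn_ord i.1; have := ltn_ord i.2 => h1 h2.
rewrite /co /cd /phi; case: f.1; case: f.2 => //=;
  rewrite natrB ?natrB1 //; try lia; by field.
Qed.

Lemma co_flip f z : co (flip f) z = 1 - co f z.
Proof. by rewrite /co /flip /=; case: f.1; case: f.2 => /=; lra. Qed.

Lemma cd_flip f i : cd (flip f) i = (N.-1 - cd f i)%N.
Proof.
have := ltn_ord i.1; have := ltn_ord i.2.
rewrite /cd /flip /=; case: f.1; case: f.2 => /=; lia.
Qed.

Lemma co_inj f g z z' : f.1 != g.1 -> co f z = co f z' -> co g z = co g z' -> z = z'.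
Proof.
case: f g z z' => [[] s] [[] s'] // [a b] [a' b'] _; rewrite /co /=;
case: s; case: s' => /= h1 h2; congr pair; lra.
Qed.

Lemma cd_inj f g i j : f.1 != g.1 -> cd f i = cd f j -> cd g i = cd g j -> i = j.
Proof.
have := ltn_ord i.1; have := ltn_ord i.2; have := ltn_ord j.1; have := ltn_ord j.2.
case: f g i j => [[] s] [[] s'] // [a b] [a' b'] /= ? ? ? ? _; rewrite /cd /=;
case: s; case: s' => /= h1 h2; congr pair; apply: val_inj => /=; lia.
Qed.

Lemma phi_inj i : injective (@phi R N i).
Proof.
move=> z z' e; have n0 := natN_neq0 R N2.
have h f : co f z = co f z'.
  have := coE f i z; rewrite e coE => /(mulIf _) h; have := h (invr_neq0 n0); lra.
exact: (@co_inj (true, false) (false, false)).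
Qed.

Definition fixpt i : R * R := ((i.1 : nat)%:R / (N%:R - 1), (i.2 : nat)%:R / (N%:R - 1)).

Lemma co_fixpt f i : co f (fixpt i) = (cd f i)%:R / (N%:R - 1).
Proof.
have n1 := natN1_neq0 R N2; have := ltn_ord i.1; have := ltn_ord i.2 => h1 h2.
rewrite /co /cd /fixpt; case: f.1; case: f.2 => //=;
  rewrite natrB ?natrB1 //; try lia; by field.
Qed.

Lemma phi_fixpt i : phi i (fixpt i) = fixpt i.
Proof.
have n1 := natN1_neq0 R N2; have n0 := natN_neq0 R N2.
by apply: (@co_inj (true, false) (false, false)) => //; rewrite coE !co_fixpt; field; rewrite n1 n0.
Qed.

Lemma phi_continuous i : continuous (@phi R N i).
Proof.
move=> z.
have h1 : ((x.1 + (i.1 : nat)%:R) / N%:R : R) @[x --> z] --> ((z.1 + (i.1 : nat)%:R) / N%:R : R).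
  apply: cvgM; last exact: cvg_cst.
  by apply: cvgD; [exact: cvg_fst|exact: cvg_cst].
have h2 : ((x.2 + (i.2 : nat)%:R) / N%:R : R) @[x --> z] --> ((z.2 + (i.2 : nat)%:R) / N%:R : R).
  apply: cvgM; last exact: cvg_cst.
  by apply: cvgD; [exact: cvg_snd|exact: cvg_cst].
exact: (cvg_pair h1 h2).
Qed.

Lemma phiw_continuous (w : seq (digit N)) : continuous (@phiw R N w).
Proof.
elim: w => [|i w IH]; first by move=> z; exact: cvg_id.
by move=> z; apply: continuous_comp; [exact: IH|exact: phi_continuous].
Qed.

Lemma phiw_cat (w u : seq (digit N)) z : phiw (w ++ u) z = phiw w (phiw u z) :> R * R.
Proof. by elim: w => //= i w ->. Qed.
End Coordinates.

(* [lia] is very slow in a context with many hypotheses on real numbers. *)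
Ltac nat_lia :=
  repeat match goal with
  | H : ?P |- _ => lazymatch P with
    | @eq ?T _ _ => tryif unify T nat then fail else clear H
    | ~ @eq ?T _ _ => tryif unify T nat then fail else clear H
    | is_true (leq _ _) => fail
    | nat => fail
    | _ => clear H
    end
  end; lia.

(** * Ultrafilters and locally constant sets *)

Lemma fmap_ultra (S T : Type) (f : S -> T) (U : set_system S) :
  UltraFilter U -> UltraFilter (f @ U).
Proof.
move=> UU; split=> [|G GF sG]; first exact: fmap_proper_filter.
apply/seteqP; split=> // A GA; have [//|UnA] := in_ultra_setVsetC (f @^-1` A) UU.
have GnA : G (~` A) by apply: sG.
have GI : G (A `&` ~` A) by exact: filterI.
by rewrite setICr in GI; case: (@filter_not_empty _ G GF).
Qed.

Lemma ultra_pigeonhole (S : Type) (I : finType) (f : S -> I) (U : set_system S) :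
  UltraFilter U -> exists i, U [set s | f s = i].
Proof.
move=> UU; apply: contrapT => no.
have h i : \forall s \near U, (fun s => f s <> i) s.
  by have [Ui|//] := in_ultra_setVsetC [set s | f s = i] UU; case: no; exists i.
have hU : \forall s \near U, forall i, f s <> i by exact: filter_forall.
by have [s /(_ (f s))] := filter_ex hU.
Qed.

(** Both [A] and its complement are relatively open in [X]. *)
Lemma connected_locally_constant (T : topologicalType) (X A : set T) : connected X ->
  (forall z, X z -> exists W, [/\ open W, W z & forall y, X y -> W y -> (A z <-> A y)]) ->
  forall y z, X y -> X z -> A y -> A z.
Proof.
move=> cX loc y z Xy Xz Ay.
pose opens (B : set T) := [set W | open W /\ forall p, X p -> W p -> B p].
have bO B : open (\bigcup_(W in opens B) W) by apply: bigcup_open => W [].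
have XA : X `&` A = X.
  apply: cX; first by exists y.
    exists (\bigcup_(W in opens A) W); first exact: bO.
    apply/seteqP; split=> p [Xp].
      move=> Ap; split=> //; have [W [oO Op hO]] := loc p Xp.
      by exists W => //; split=> // q Xq Oq; apply/(hO q Xq Oq).
    by case=> W [_ h] Op; split=> //; exact: h.
  exists (~` \bigcup_(W in opens (~` A)) W); first by rewrite closedC; exact: bO.
  apply/seteqP; split=> p [Xp].
    by move=> Ap; split=> // -[W [_ h] Op]; exact: (h p Xp Op).
  move=> nO; split=> //; apply: contrapT => nAp; apply: nO.
  have [W [oO Op hO]] := loc p Xp; exists W => //; split=> // q Xq Oq Aq.
  by apply: nAp; apply/(hO q Xq Oq).
by have : (X `&` A) z by [rewrite XA]; case.
Qed.

Definition cylinder (R : realType) (N : nat) (F : set (R * R)) (w : seq (digit N)) :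
  set (R * R) := phiw w @` F.

(** * Elementary geometry of the cells of a carpet *)

Section Carpet.
Variables (R : realType) (N : nat) (D : {set digit N}) (F : set (R * R)).
Hypothesis N2 : (2 <= N)%N.
Hypothesis gscF : is_GSC D F.
Hypothesis D2 : (1 < #|D|)%N.
Hypothesis conF : connected F.
Implicit Types (f g : frame) (y z : R * R) (i j : digit N).
Notation cell := (cylinder F).
Notation inD := (all (fun i => i \in D)).

Lemma F_phi i z : i \in D -> F z -> F (phi i z).
Proof.
by case: gscF => _ [_ FE] iD Fz; rewrite FE; exists i => //; exists z.
Qed.

Lemma F_decomp z : F z -> exists i y, [/\ i \in D, F y & z = phi i y].
Proof.
by case: gscF => _ [_ FE]; rewrite {1}FE => -[i iD [y Fy <-]]; exists i, y.
Qed.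

Lemma F_neq0 : F !=set0. Proof. by case: gscF => _ []. Qed.

Lemma F_closed : closed F.
Proof. by case: gscF => cF _; apply: compact_closed => //; exact: norm_hausdorff. Qed.

Lemma F_bounded : exists M, forall f z, F z -> `|co f z| <= M.
Proof.
case: gscF => /compact_bounded[M [Mr hM]] _.
exists (1 + (M + 1)) => f z /hM h.
have hz : `|z| <= M + 1 by apply: h; lra.
have z1 : `|z.1| <= M + 1 by apply: le_trans hz; rewrite prod_normE le_max lexx.
have z2 : `|z.2| <= M + 1 by apply: le_trans hz; rewrite prod_normE le_max lexx orbT.
rewrite /co; case: f.1; case: f.2; rewrite ?(le_trans (ler_normB _ _)) ?normr1; lra.
Qed.

(** A negative coordinate becomes at least [N] times as negative with each passage to a preimage in
    [F], whereas [F] is bounded. *)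
Lemma F_ge0 f z : F z -> 0 <= co f z.
Proof.
move=> Fz; have [M hM] := F_bounded; have n0 := natN_gt0 R N2.
rewrite -oppr_le0; apply: (@bounded_exp_le0 _ _ N2 _ M) => k.
elim: k z Fz => [|k IH] z Fz.
  rewrite expr0 mulr1; apply: le_trans (hM f z Fz); rewrite -normrN; exact: ler_norm.
have [i [y [iD Fy ->]]] := F_decomp Fz.
apply: le_trans (IH y Fy).
rewrite coE // exprS mulrA ler_pM2r ?exprn_gt0 //.
rewrite mulNr divfK ?lt0r_neq0 // lerN2.
by have : 0 <= (cd f i)%:R :> R by []; lra.
Qed.

Lemma F01 f z : F z -> 0 <= co f z <= 1.
Proof.
move=> Fz; rewrite F_ge0 //=; have := F_ge0 (flip f) Fz; rewrite co_flip; lra.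
Qed.

Lemma touchE f i j y z : phi i y = phi j z -> co f y + (cd f i)%:R = co f z + (cd f j)%:R.
Proof.
move=> e; have n0 := natN_neq0 R N2; have := coE N2 f i y; rewrite e coE //.
by move/(mulIf (invr_neq0 n0)) => ->.
Qed.

Lemma touch_intro f g i j y z : f.1 != g.1 ->
  co f y + (cd f i)%:R = co f z + (cd f j)%:R ->
  co g y + (cd g i)%:R = co g z + (cd g j)%:R -> phi i y = phi j z.
Proof. by move=> fg e1 e2; apply: (co_inj fg); rewrite !coE // ?e1 ?e2. Qed.

Lemma touch_cases f i j y z : F y -> F z -> phi i y = phi j z ->
  [\/ cd f i = cd f j /\ co f y = co f z,
      [/\ cd f i = (cd f j).+1, co f y = 0 & co f z = 1]
    | [/\ cd f j = (cd f i).+1, co f y = 1 & co f z = 0]].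
Proof. by move=> Fy Fz /(touchE f); apply: touch1; exact: F01. Qed.

Lemma cell_consE i w z : cell (i :: w) z <-> exists2 y, cell w y & z = phi i y.
Proof.
split=> [[y Fy <-]|[_ [y Fy <-] ->]]; last by exists y.
by exists (phiw w y) => //; exists y.
Qed.

Lemma cell_phi i w y : cell (i :: w) (phi i y) <-> cell w y.
Proof.
rewrite cell_consE; split=> [[y' Cy /(phi_inj N2) ->] //|Cy].
by exists y.
Qed.

Lemma cell_nil : cell ([::] : seq (digit N)) = F.
Proof. by rewrite /cylinder /= image_id. Qed.

Lemma cell1 i y : cell [:: i] (phi i y) <-> F y.
Proof. by rewrite cell_phi cell_nil. Qed.

Lemma cell_sub w : inD w -> cell w `<=` F.
Proof.
elim: w => [_|i w IH /= /andP[iD wD] z]; first by rewrite cell_nil.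
by rewrite cell_consE => -[y /(IH wD) Fy ->]; exact: F_phi.
Qed.

Lemma cell_catE (w u : seq (digit N)) z : cell (w ++ u) z <-> exists2 y, cell u y & z = phiw w y.
Proof.
split=> [[y Fy <-]|[_ [y Fy <-] ->]].
  by exists (phiw u y); [exists y|rewrite phiw_cat].
by exists y => //; rewrite phiw_cat.
Qed.

Lemma cell_prefix w u : inD u -> cell (w ++ u) `<=` cell w.
Proof.
by move=> uD z; rewrite cell_catE => -[y /(cell_sub uD) Fy ->]; exists y.
Qed.

Lemma cell_neq0 (w : seq (digit N)) : cell w !=set0.
Proof. by have [z Fz] := F_neq0; exists (phiw w z), z. Qed.

Lemma cell_closed (w : seq (digit N)) : closed (cell w).
Proof.
apply: compact_closed; first exact: norm_hausdorff.
apply: continuous_compact; last by case: gscF.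
exact: (continuous_subspaceT (@phiw_continuous R N w)).
Qed.

Lemma cell_connected (w : seq (digit N)) : connected (cell w).
Proof.
apply: connected_continuous_connected => //.
exact: (continuous_subspaceT (@phiw_continuous R N w)).
Qed.

Lemma cover z k : F z -> exists w, [/\ size w = k, inD w & cell w z].
Proof.
elim: k z => [|k IH] z Fz; first by exists [::]; split => //; rewrite cell_nil.
have [i [y [iD Fy ->]]] := F_decomp Fz; have [w [sw wD wy]] := IH y Fy.
by exists (i :: w); split; rewrite /= ?sw ?iD //; apply/cell_phi.
Qed.

Lemma cover_cell w z k : cell w z ->
  exists u, [/\ size u = k, inD u & cell (w ++ u) z].
Proof.
move=> [y Fy <-]; have [u [su uD uy]] := cover k Fy.
by exists u; split => //; rewrite cell_catE; exists y.
Qed.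

Lemma cell_diam f w y z : inD w -> cell w y -> cell w z ->
  (co f y - co f z) * N%:R ^+ size w <= 1.
Proof.
have n0 := natN_neq0 R N2.
elim: w y z => [|i w IH] y z /=.
  move=> _; rewrite cell_nil => Fy Fz; have := F01 f Fy; have := F01 f Fz; rewrite expr0; lra.
move=> /andP[iD wD] /cell_consE[y' wy ->] /cell_consE[z' wz ->].
apply: le_trans (IH y' z' wD wy wz); rewrite !coE // exprS le_eqVlt; apply/orP; left.
by apply/eqP; field.
Qed.

Lemma separating_level y z : y <> z ->
  exists k, forall w, size w = k -> inD w -> cell w y -> ~ cell w z.
Proof.
move=> yz; apply: contrapT => no; apply: yz.
have h f : co f y = co f z.
  suff le2 a b : (a = y /\ b = z \/ a = z /\ b = y) -> co f a - co f b <= 0.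
    apply/le_anti; rewrite -subr_le0 le2 /=; last by left.
    by rewrite -subr_le0 le2 //; right.
  move=> ab; apply: (@bounded_exp_le0 _ _ N2 _ 1) => k.
  have [w [sw wD wy wz]] : exists w, [/\ size w = k, inD w, cell w y & cell w z].
    apply: contrapT => no2; apply: no; exists k => w sw wD wy wz.
    by apply: no2; exists w.
  by rewrite -sw; case: ab => -[-> ->]; apply: cell_diam.
exact: (@co_inj _ (true, false) (false, false)).
Qed.

(** The iterates under [phi i] of any point of [F] converge to the fixed point, and [F] is
    closed. *)
Lemma fixpt_in i : i \in D -> F (fixpt R i).
Proof.
move=> iD; have [z Fz] := F_neq0.
apply: F_closed => B /nbhs_ballP[e /= e0 eB].
pose it k := iter k (phi i) z.
have Fit k : F (it k) by elim: k => [|k IH] //=; exact: F_phi.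
have dit f k : `|co f (fixpt R i) - co f (it k)| * N%:R ^+ k <= `|co f (fixpt R i) - co f z|.
  elim: k => [|k IH]; first by rewrite expr0 mulr1.
  apply: le_trans IH; rewrite /it /= -/(it k) -{1}(phi_fixpt R N2 i) !coE //.
  rewrite -mulrBl normrM [`|N%:R^-1|]ger0_norm ?invr_ge0 ?ler0n //.
  rewrite exprS mulrA divfK ?natN_neq0 //.
  have -> : co f (fixpt R i) + (cd f i)%:R - (co f (it k) + (cd f i)%:R) =
    co f (fixpt R i) - co f (it k) by ring.
  exact: lexx.
have near_ f : exists k0, forall k, (k0 <= k)%N -> `|co f (fixpt R i) - co f (it k)| < e.
  set M := `|co f (fixpt R i) - co f z| in dit *.
  pose k0 := Num.bound (M / e).
  have kb : M / e < k0%:R by apply: archi_boundP; rewrite divr_ge0 ?normr_ge0 ?(ltW e0).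
  exists k0 => m km; rewrite ltNge; apply/negP => em.
  have := dit f m; apply/negP; rewrite -ltNge.
  have : M < e * N%:R ^+ m.
    rewrite ltr_pdivrMr // mulrC in kb; apply: lt_le_trans kb _.
    rewrite ler_pM2l // -natrX ler_nat (leq_trans km) // ltnW // ltn_expl; lia.
  move/lt_le_trans; apply; rewrite ler_pM2r // exprn_gt0 // natN_gt0 //.
have [k1 h1] := near_ (true, false); have [k2 h2] := near_ (false, false).
exists (it (maxn k1 k2)); split; first exact: Fit.
by apply: eB; split; rewrite /ball /=; [apply: h1; exact: leq_maxl|apply: h2; exact: leq_maxr].
Qed.

Lemma fixpt_only i j y : F y -> phi j y = fixpt R i -> j = i.
Proof.
move=> Fy e.
have h f : cd f j = cd f i.
  apply: (@fixpoint_digit R N N2 _ _ (co f y)); rewrite ?cd_lt ?F01 //.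
  by rewrite -co_fixpt // -e coE // mulrC divfK ?natN_neq0.
exact: (@cd_inj N N2 (true, false) (false, false)).
Qed.

(** * Sets of words and tails of the Hata graphs *)

Definition word_union k (S : {set k.-tuple (digit N)}) : set (R * R) :=
  union (fun w : k.-tuple (digit N) => cell w) S.

Definition headed k (i : digit N) : {set k.+1.-tuple (digit N)} :=
  [set w in words D k.+1 | thead w == i]%SET.

Lemma in_words k (w : k.-tuple (digit N)) : (w \in words D k) = inD w.
Proof. by rewrite inE. Qed.

Lemma connect_words k (S : {set k.-tuple (digit N)}) : connected (word_union S) ->
  {in S &, forall a b, connect (restr_rel S (hata_rel F k)) a b}.
Proof.
move=> conS x y xS yS; pose P := component S (hata_rel F k) x.
have PS : P \subset S by apply/fintype.subsetP => z; rewrite inE => /andP[].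
have [PE|PnS] := eqVneq P S.
  have : y \in P by rewrite PE.
  by rewrite inE => /andP[].
have P0 : P != finset.set0.
  by apply/finset.set0Pn; exists x; rewrite /P /component inE xS connect0.
have [i [j [iP jS jP ij]]] := linked_of_connected
  (fun w : k.-tuple (digit N) => @cell_closed w)
  (fun w : k.-tuple (digit N) => @cell_neq0 w) conS PS P0 PnS.
have nij : i != j by apply: contraNneq jP => <-.
case/negP: jP; move: iP; rewrite !inE => /andP[iS xi]; rewrite jS /=.
apply: connect_trans xi _; apply: connect1; rewrite /restr_rel /= iS jS /hata_rel /= nij.
exact/asboolP.
Qed.

Lemma card_headed k i : i \in D -> #|headed k i| = #|words D k|.
Proof.
move=> iD.
have -> : headed k i = ((fun u : k.-tuple (digit N) => cons_tuple i u) @: words D k)%SET.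
  apply/setP => w; rewrite !inE; apply/andP/imsetP => [[wD /eqP wi]|[u uD ->]].
    exists (behead_tuple w).
      by rewrite inE; move: wD; rewrite {1}(tuple_eta w) /= => /andP[].
    by apply: val_inj => /=; rewrite {1}(tuple_eta w) wi.
  by move: uD; rewrite inE theadE => uD; rewrite /= iD uD eqxx.
rewrite card_imset // => u v.
by move=> /(congr1 (fun w : k.+1.-tuple _ => behead_tuple w)) /(congr1 val) /= /val_inj.
Qed.

Lemma card_words k : #|words D k| = (#|D| ^ k)%N.
Proof.
elim: k => [|k IH].
  rewrite expn0; apply/eqP/cards1P; exists [tuple]; apply/setP => w.
  by rewrite (tuple0 w) !inE.
have -> : words D k.+1 =
    ((fun p : digit N * k.-tuple (digit N) => cons_tuple p.1 p.2) @: finset.setX D (words D k))%SET.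
  apply/setP => w; rewrite in_words; apply/idP/imsetP => [wD|[[i u]]].
    exists (thead w, behead_tuple w); last by apply: val_inj => /=; rewrite {1}(tuple_eta w).
    by move: wD; rewrite inE in_words /= {1}(tuple_eta w).
  by rewrite inE in_words /= => /andP[iD uD] -> /=; rewrite iD.
rewrite card_imset; first by rewrite cardsX IH expnS.
move=> [i u] [j v] /(congr1 val) /= [-> /val_inj ->] //.
Qed.

(** Geometric form of [chi_ge]: connected unions of cells replace connected sets of vertices, and no
    cell of [P] meets a remaining cell outside [P]. *)
Lemma chi_cut k m q (S1 S2 P : {set k.-tuple (digit N)}) : (0 < m)%N -> q \in words D k ->
  S1 \subset words D k :\ q -> S2 \subset words D k :\ q ->
  connected (word_union S1) -> connected (word_union S2) ->
  S1 \subset P -> (forall w, w \in S2 -> w \notin P) ->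
  (forall w u z, w \in words D k -> u \in words D k -> w != q -> u != q ->
     w \in P -> u \notin P -> cell w z -> ~ cell u z) ->
  (m <= #|S1|)%N -> (m <= #|S2|)%N -> (m <= chi (words D k) (hata_rel F k))%N.
Proof.
move=> m0 qD s1 s2 c1 c2 p1 p2 cross h1 h2.
have mono (S : {set k.-tuple (digit N)}) : S \subset words D k :\ q -> connected (word_union S) ->
  {in S &, forall a b, connect (restr_rel (words D k :\ q) (hata_rel F k)) a b}.
  move=> sS cS x y xS yS; have := connect_words cS xS yS; apply: connect_sub.
  move=> a b /= /and3P[aS bS ab]; apply: connect1.
  by apply/and3P; split=> //; exact: (fintype.subsetP sS).
have p2' : fintype.disjoint (mem S2) (mem P).
  by rewrite finset.disjoints_subset; apply/fintype.subsetP => w /p2; rewrite inE.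
apply: (chi_ge m0 qD s1 s2 (mono _ s1 c1) (mono _ s2 c2) _ p1 p2' h1 h2).
move=> a b aP; rewrite /restr_rel /= !in_setD1 => /and3P[/andP[aq aD] /andP[bq bD]].
case/andP => _ /asboolP[z [az bz]]; apply: contraT => bP.
by case: (cross a b z).
Qed.

Lemma headed_union k i : i \in D -> word_union (headed k i) = cell [:: i].
Proof.
move=> iD; apply/seteqP; split=> z.
  case=> w; rewrite inE in_words => /andP[wD /eqP wi].
  have e : tval w = [:: i] ++ behead w by rewrite {1}(tuple_eta w) wi.
  move: wD; rewrite e /= => /andP[_ wD].
  exact: (cell_prefix (w := [:: i]) wD).
move=> iz; have [u [su uD uz]] := cover_cell k iz.
exists (cons_tuple i (Tuple (introT eqP su))) => //.
by rewrite inE in_words /= iD uD theadE eqxx.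
Qed.

Lemma headed_connected k i : i \in D -> connected (word_union (headed k i)).
Proof. by move=> iD; rewrite headed_union //; apply: cell_connected. Qed.

(** The tails are the blocks of all words with head [i1] or [i2]. They avoid the deleted word, have
    [|D| ^ k] elements each, and are connected because their unions are first-level cells. *)
Lemma chi_full k a q i1 i2 (P : seq (digit N) -> Prop) :
  size q = k -> inD (a :: q) -> i1 \in D -> i2 \in D -> a != i1 -> a != i2 ->
  (forall w, inD w -> P (i1 :: w)) -> (forall w, inD w -> ~ P (i2 :: w)) ->
  (forall w u z, size w = k.+1 -> size u = k.+1 -> inD w -> inD u ->
     w <> a :: q -> u <> a :: q -> P w -> ~ P u -> cell w z -> ~ cell u z) ->
  (#|D| ^ k <= chi (words D k.+1) (hata_rel F k.+1))%N.
Proof.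
move=> sq qD i1D i2D ai1 ai2 P1 P2 cross.
have sq1 : size (a :: q) == k.+1 by rewrite /= sq.
pose q1 := Tuple sq1.
have hd i : i \in D -> a != i -> headed k i \subset words D k.+1 :\ q1.
  move=> iD ai; apply/fintype.subsetP => w; rewrite !inE => /andP[-> /eqP wi]; rewrite andbT.
  by apply: contraNneq ai => wq; rewrite -wi wq.
have sz (w : k.+1.-tuple (digit N)) : size w = k.+1 by exact: size_tuple.
have hdw i (w : k.+1.-tuple (digit N)) : w \in headed k i ->
    exists2 u, inD u & tval w = i :: u.
  rewrite inE in_words => /andP[wD /eqP wi]; exists (behead w).
    by move: wD; rewrite {1}(tuple_eta w) /= => /andP[].
  by rewrite {1}(tuple_eta w) wi.
apply: (@chi_cut _ _ q1 (headed k i1) (headed k i2) [set w | `[< P (tval w) >]]%SET).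
- by rewrite expn_gt0; lia.
- by rewrite in_words.
- exact: hd.
- exact: hd.
- exact: headed_connected.
- exact: headed_connected.
- by apply/fintype.subsetP => w /hdw[u uD wu]; rewrite inE; apply/asboolP; rewrite wu; exact: P1.
- by move=> w /hdw[u uD wu]; rewrite inE; apply/asboolPn; rewrite wu; exact: P2.
- move=> w u z; rewrite !in_words => wD uD wq uq; rewrite !inE => Pw /asboolPn Pu.
  have ne (v : k.+1.-tuple (digit N)) : v != q1 -> tval v <> a :: q.
    by move=> vq e; case/eqP: vq; apply: val_inj.
  exact: (cross w u z (sz w) (sz u) wD uD (ne _ wq) (ne _ uq) Pw Pu).
- by rewrite card_headed // card_words.
- by rewrite card_headed // card_words.
Qed.

(* Only the behaviour of the two sides of a cut point with respect to cells is kept. *)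
Definition separation x (A : set (R * R)) :=
  [/\ F x, (forall z, A z -> F z /\ z <> x), A !=set0,
      (exists z, [/\ F z, z <> x & ~ A z]) &
      forall w, inD w -> ~ cell w x -> forall y z, cell w y -> cell w z -> A y -> A z].

Definition coside x (A : set (R * R)) : set (R * R) := [set z | [/\ F z, z <> x & ~ A z]].

Definition pull i (A : set (R * R)) : set (R * R) := [set z | F z /\ A (phi i z)].

Definition simple z := forall w u, size w = size u -> inD w -> inD u ->
  cell w z -> cell u z -> w = u.

Definition pinch (I : {set digit N}) x := [/\ I \subset D, I != finset.set0, I != D &
   forall i j y z, i \in I -> j \in D -> j \notin I -> F y -> F z ->
     phi i y = phi j z -> phi i y = x].

Definition fragile := exists I x, pinch I x.

(** * Separations of the carpet by a point *)

Lemma separation_coside x A : separation x A -> separation x (coside x A).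
Proof.
case=> Fx AF [a Aa] [b Bb] cA; split=> //.
- by move=> z [].
- by exists b.
- by have [Fa ax] := AF _ Aa; exists a; split=> // -[].
- move=> w wD wx y z wy wz [Fy yx nAy]; split.
  + exact: cell_sub wz.
  + by move=> zx; apply: wx; rewrite -zx.
  + by move=> Az; apply: nAy; apply: (cA w wD wx z y).
Qed.

Lemma separation_sub x A w y z : separation x A -> inD w -> ~ cell w x ->
  cell w y -> cell w z -> A y -> A z.
Proof. by case=> _ _ _ _ h wD wx wy wz; apply: (h w). Qed.

Lemma cut_separation x : cut_point F x -> exists A, separation x A.
Proof.
move=> [Fx /connectedPn[E [En FE sep]]]; exists (E true).
have EF b z : E b z -> F z /\ z <> x.
  move=> Ez; have : (F `\ x) z by rewrite FE; case: b Ez => Ez; [right|left].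
  by case.
have dis z : E false z -> E true z -> False.
  move=> e0 e1; have [s _] := sep; suff : set0 z by [].
  by rewrite -s; split=> //; apply: subset_closure.
split=> //; first exact: EF.
- have [z Ez] := En false; have [Fz zx] := EF _ _ Ez.
  by exists z; split=> // /(dis _ Ez).
- move=> w wD wx y z wy wz Ey.
  have sub : cell w `<=` E false `|` E true.
    rewrite -FE => p wp; split; first exact: cell_sub wp.
    by move=> px; apply: wx; rewrite -px.
  have [h|h] := connected_subset sep sub (@cell_connected w); last exact: h.
  by case: (dis y) => //; exact: h.
Qed.

Lemma separation_pull i x A : i \in D -> F x -> separation (phi i x) A ->
  (exists z, F z /\ A (phi i z)) -> (exists z, coside (phi i x) A (phi i z) /\ F z) ->
  separation x (pull i A).
Proof.
move=> iD Fx [_ AF _ _ cA] hA [b [[_ bx nAb] Fb]]; split=> //.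
- move=> z [Fz Az]; split=> // zx; have [_] := AF _ Az; by rewrite zx.
- exists b; split=> // [bE|[_]//]; by apply: bx; rewrite bE.
- move=> w wD wx y z wy wz [_ Ay]; split; first exact: cell_sub wz.
  apply: (cA (i :: w) _ _ (phi i y)) => //=; rewrite ?iD //; first by rewrite cell_phi.
  + exact/cell_phi.
  + exact/cell_phi.
Qed.

Lemma simple_pull i x : i \in D -> simple (phi i x) -> simple x.
Proof.
move=> iD sx w u sz wD uD wx ux.
have := sx (i :: w) (i :: u); rewrite /= sz iD => /(_ erefl wD uD).
by rewrite !cell_phi => /(_ wx ux) [].
Qed.

Lemma simple_digit x i j y : simple x -> i \in D -> j \in D -> cell [:: i] x ->
  F y -> x = phi j y -> j = i.
Proof.
move=> sx iD jD ix Fy xy; have jx : cell [:: j] x by rewrite xy cell1.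
have := sx [:: i] [:: j]; rewrite /= iD jD => /(_ erefl erefl erefl ix jx).
by case.
Qed.

Lemma cell1P i x : cell [:: i] x <-> exists y, F y /\ x = phi i y.
Proof.
split=> [/cell_consE[y]|[y [Fy ->]]]; first by rewrite cell_nil; exists y.
exact/cell1.
Qed.

Lemma linkD (P : {set digit N}) : P \subset D -> P != finset.set0 -> P != D ->
  exists i j y z, [/\ i \in P, j \in D, j \notin P & [/\ F y, F z & phi i y = phi j z]].
Proof.
move=> PD P0 PnD.
have uD : union (fun i => cell [:: i]) D = F.
  apply/seteqP; split=> z.
    by move=> [i iD /cell1P[y [Fy ->]]]; exact: F_phi.
  by move=> /F_decomp[i [y [iD Fy ->]]]; exists i => //; exact/cell1.
have [|i [j [iP jD jP [z [/cell1P[y [Fy ->]] /cell1P[y' [Fy' e]]]]]]] :=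
  @linked_of_connected _ _ (fun i => cell [:: i]) D P (fun i => @cell_closed [:: i])
    (fun i => cell_neq0 [:: i]) _ PD P0 PnD.
  by rewrite uD.
by exists i, j, y, y'.
Qed.

Lemma link_digit i : i \in D -> exists j y z,
  [/\ j \in D, j != i & [/\ F y, F z & phi i y = phi j z]].
Proof.
move=> iD; have [||| i' [j [y [z [+ jD ji h]]]]] := @linkD [set i]%SET.
- by rewrite finset.sub1set.
- by apply/finset.set0Pn; exists i; rewrite inE.
- by apply: contraTneq D2 => <-; rewrite cards1.
rewrite inE => /eqP ei; subst i'; exists j, y, z; split=> //.
by move: ji; rewrite inE.
Qed.

(** Otherwise every cell that meets [A] misses [x], hence lies in [A], and so do its neighbours. The
    digits of these cells would then form a proper part of [D] without link to the rest. *)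
Lemma separation_near i x A : separation x A -> i \in D ->
  (forall l, l \in D -> cell [:: l] x -> l = i) -> exists y, F y /\ A (phi i y).
Proof.
move=> sA iD only; have [Fx AF [a Aa] _ cA] := sA; apply: contrapT => no.
pose P : {set digit N} := [set l in D | `[< exists y, F y /\ A (phi l y) >]]%SET.
have inP l y : l \in D -> F y -> A (phi l y) -> l \in P.
  by move=> lD Fy Ay; rewrite inE lD; apply/asboolP; exists y.
have [||| l [l' [y [z [lP l'D l'P [Fy Fz e]]]]]] := @linkD P.
- by apply/fintype.subsetP => l; rewrite inE => /andP[].
- have [/F_decomp[l [y [lD Fy ay]]] _] := AF _ Aa.
  by apply/finset.set0Pn; exists l; apply: (inP l y) => //; rewrite -ay.
- apply: contra_notN no => /eqP PD; move: iD; rewrite -PD inE => /andP[_ /asboolP//].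
move: (lP); rewrite inE => /andP[lD /asboolP[y' [Fy' Ay']]].
case/negP: l'P; apply: (inP l' z) => //; rewrite -e.
apply: (separation_sub sA (w := [:: l]) _ _ _ _ Ay'); rewrite ?cell1 //= ?lD //.
move=> /(only _ lD) li; apply: no; exists y'; by rewrite -li.
Qed.

(** * Descent of a small side through the cells of a cut point *)

Definition small v (A : set (R * R)) :=
  forall j z, j \in D -> j != v -> F z -> ~ A (phi j z).

(** The index is shifted: this is the condition of the theorem at level [k + 1]. *)
Definition long_tail k := (#|D| ^ k - 1 <= chi (words D k.+1) (hata_rel F k.+1))%N.

(** If both sides reach first-level cells other than that of [v], deleting the cell of [x] of level
    [k + 1] leaves two full blocks in different components. *)
Lemma simple_small k x A v : ~ long_tail k -> separation x A -> simple x -> v \in D ->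
  cell [:: v] x -> small v A \/ small v (coside x A).
Proof.
move=> nk sA sx vD vx; apply: contrapT => no; apply: nk.
have [Fx AF _ _ cA] := sA.
have [i1 [z1 [i1D i1v Fz1 Az1]]] : exists j z, [/\ j \in D, j != v, F z & A (phi j z)].
  apply: contrapT => no1; apply: no; left => j z jD jv Fz Az; apply: no1; by exists j, z.
have [i2 [z2 [i2D i2v Fz2 Bz2]]] :
    exists j z, [/\ j \in D, j != v, F z & coside x A (phi j z)].
  apply: contrapT => no1; apply: no; right => j z jD jv Fz Az; apply: no1; by exists j, z.
have nx j : j \in D -> j != v -> ~ cell [:: j] x.
  by move=> jD jv /cell1P[y [Fy xy]]; case/eqP: jv; apply: (simple_digit sx vD jD vx Fy xy).
have [[|a q] [] // [sq] qD qx] := cover k.+1 Fx.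
have aD : a \in D by case/andP: qD.
have av : a = v.
  have [y Cy xy] := (iffLR (cell_consE a q x)) qx.
  have /andP[_ qD'] := qD.
  by apply: (simple_digit sx vD aD vx (cell_sub qD' Cy) xy).
subst a; apply: leq_trans (leq_subr _ _) _.
apply: (@chi_full k v q i1 i2 (fun w => cell w `<=` A)) => //; rewrite 1?eq_sym //.
- move=> w wD z; rewrite -cat1s => /(cell_prefix wD) wz.
  by apply: (separation_sub sA _ (nx _ i1D i1v) _ wz Az1); rewrite ?cell1 //= i1D.
- move=> w wD sub; have [z wz] := cell_neq0 (i2 :: w).
  have Az := sub _ wz; case: Bz2 => _ _; apply.
  move: wz; rewrite -cat1s => /(cell_prefix wD) wz.
  by apply: (separation_sub sA _ (nx _ i2D i2v) wz _ Az); rewrite ?cell1 //= i2D.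
- move=> w u z sw su wD uD wq uq sub nsub wz uz; apply: nsub => y uy.
  apply: (separation_sub sA uD _ uz uy (sub _ wz)) => ux; apply: uq.
  by apply: sx => //; rewrite su /= sq.
Qed.

(* [Attached r x B v]: the cell of [r] is attached to the rest of the carpet through
   the side [B] of the cut point [x] only, and [B] lies in the subcell of [v]. *)
Definition Attached r x (B : set (R * R)) v :=
  [/\ separation x B, simple x, [/\ r \in D, v \in D & cell [:: v] x], small v B &
   forall j y z, j \in D -> j != r -> F y -> F z -> phi r y = phi j z -> B y].

(** After pulling back into the cell of [v], one of the two sides is small again. If it is the other
    side, the cell of [v] is attached through it, since [A] does not leave that cell. If it is [A],
    the descent continues; it ends because [T], a level that separates some [a] of [A] from [x],
    drops by one. When the fixed point of [v] is in [A], all cells met on the way are that of [v],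
    so [r = v]. *)
Lemma descent k T x A v : ~ long_tail k -> separation x A -> simple x -> v \in D ->
  cell [:: v] x -> small v A ->
  (exists a, A a /\ forall w, size w = T -> inD w -> cell w a -> ~ cell w x) ->
  exists r x' B v', Attached r x' B v' /\ (A (fixpt R v) -> r = v /\ ~ B (fixpt R v)).
Proof.
move=> nk; elim: T x A v => [|T IH] x A v sA sx vD vx smA [a [Aa sep]].
  have [Fx AF _ _ _] := sA; have [Fa _] := AF _ Aa.
  by case: (sep [::]); rewrite ?cell_nil.
have [Fx AF _ _ cA] := sA.
have [x1 [Fx1 xE]] := (iffLR (cell1P v x)) vx; subst x.
have inv z : A z -> exists y, F y /\ z = phi v y.
  move=> Az; have [/F_decomp[i [y [iD Fy e]]] _] := AF _ Az.
  have [iv|iv] := eqVneq i v; first by exists y; rewrite -iv.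
  by case: (smA i y iD iv Fy); rewrite -e.
have [a1 [Fa1 aE]] := inv _ Aa; subst a.
have nlink j y z : j \in D -> j != v -> F y -> F z -> phi v y = phi j z ->
    coside (phi v x1) A (phi v y).
  move=> jD jv Fy Fz e; split; first exact: F_phi.
    move=> e1; case/eqP: jv; apply: (simple_digit sx vD jD vx Fz).
    by rewrite -e1.
  by rewrite e; exact: smA.
have sA1 : separation x1 (pull v A).
  apply: separation_pull => //; first by exists a1.
  have [j [y [z [jD jv [Fy Fz e]]]]] := link_digit vD.
  by exists y; split=> //; exact: nlink e.
have sx1 := simple_pull vD sx.
have [v1 [x2 [v1D Fx2 x1E]]] := F_decomp Fx1.
have v1x : cell [:: v1] x1 by apply/cell1P; exists x2.
have FfF := fixpt_in vD; have fE := phi_fixpt R N2 v.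
have [sm|sm] := simple_small nk sA1 sx1 v1D v1x.
  have [|r [x' [B [v' [C CB]]]]] := IH x1 (pull v A) v1 sA1 sx1 v1D v1x sm.
    exists a1; split=> // w sw wD wa wx; apply: (sep (v :: w)); rewrite /= ?sw ?vD //.
    - exact/cell_phi.
    - exact/cell_phi.
  exists r, x', B, v'; split=> // Av.
  have pv : pull v A (fixpt R v) by split; rewrite ?fE.
  have vv1 : v = v1.
    apply/eqP; apply: contraT => vv1; case: (sm v (fixpt R v) vD vv1 FfF).
    by rewrite fE.
  by rewrite -vv1 in CB; exact: CB.
exists v, x1, (coside x1 (pull v A)), v1; split; last first.
  by move=> Av; split=> // -[_ _]; apply; split; rewrite ?fE.
split=> //; first exact: separation_coside.
move=> j y z jD jv Fy Fz e; have [_ yx nA] := nlink j y z jD jv Fy Fz e.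
split=> //; last by move=> [_].
by move=> yE; apply: yx; rewrite yE.
Qed.

Lemma descend k x A v : ~ long_tail k -> separation x A -> simple x -> v \in D ->
  cell [:: v] x -> small v A ->
  exists r x' B v', Attached r x' B v' /\ (A (fixpt R v) -> r = v /\ ~ B (fixpt R v)).
Proof.
move=> nk sA sx vD vx sm; have [_ AF [a Aa] _ _] := sA.
have [T sep] := separating_level (AF _ Aa).2.
by apply: (descent (T := T) nk sA sx vD vx sm); exists a.
Qed.

(* The rank counts the axes along which a point lies on the boundary of the unit
   square. It grows when a point common to two cells is pulled back to one of them. *)
Definition on_edge f z := (co f z == 0) || (co f z == 1).

Definition rank z := (on_edge (true, false) z + on_edge (false, false) z)%N.

(** * Reduction to cut points with one cell at each level *)

Lemma on_edge_phi f i y : F y -> on_edge f (phi i y) ->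
  on_edge f y /\ forall j z, F z -> phi i y = phi j z -> cd f i = cd f j.
Proof.
move=> Fy; have n0 := natN_neq0 R N2; rewrite /on_edge coE // => h.
have /orP : (co f y + (cd f i)%:R == 0) || (co f y + (cd f i)%:R == N%:R).
  case/orP: h => /eqP h.
    by rewrite -(divfK n0 (_ + _)) h mul0r eqxx.
  by rewrite -[X in X == N%:R](divfK n0 (_ + _)) h mul1r eqxx orbT.
have /andP[y0 y1] := F01 f Fy.
case=> /eqP e.
  have [c0 ->] := digit_eq0 y0 e; rewrite eqxx; split=> // j z Fz /(touchE f).
  rewrite e => /esym e'; have /andP[z0 _] := F01 f Fz.
  by have [-> _] := digit_eq0 z0 e'.
have [c0 ->] := digit_eqN N2 y1 (cd_lt N2 f i) e; rewrite eqxx orbT; split=> // j z Fz /(touchE f).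
rewrite e => /esym e'; have /andP[_ z1] := F01 f Fz.
by have [-> _] := digit_eqN N2 z1 (cd_lt N2 f j) e'.
Qed.

Lemma rank_phi i y : F y -> (rank (phi i y) <= rank y)%N.
Proof.
move=> Fy; rewrite /rank; apply: leq_add.
  by case h: (on_edge _ (phi i y)) => //; have [-> _] := on_edge_phi Fy h.
by case h: (on_edge _ (phi i y)) => //; have [-> _] := on_edge_phi Fy h.
Qed.

Lemma rank_touch i j y z : i <> j -> F y -> F z -> phi i y = phi j z ->
  (rank (phi i y) < rank y)%N.
Proof.
move=> ij Fy Fz e.
have up f : cd f i <> cd f j -> (on_edge f (phi i y) < on_edge f y)%N.
  move=> cij; have -> : on_edge f y.
    rewrite /on_edge; have [[]|[_ -> _]|[_ -> _]] // := touch_cases f Fy Fz e.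
      by rewrite eqxx.
    by rewrite eqxx orbT.
  case h: (on_edge f (phi i y)) => //; case: cij.
  by have [_ hc] := on_edge_phi Fy h; apply: hc Fz e.
have le f : (on_edge f (phi i y) <= on_edge f y)%N.
  by case h: (on_edge _ (phi i y)) => //; have [-> _] := on_edge_phi Fy h.
rewrite /rank.
have [c1|c1] := eqVneq (cd (true, false) i) (cd (true, false) j); last first.
  by rewrite -addSn; apply: leq_add => //; apply: up; apply/eqP.
have [c2|c2] := eqVneq (cd (false, false) i) (cd (false, false) j); last first.
  by rewrite -addnS; apply: leq_add => //; apply: up; apply/eqP.
by case: ij; apply: (@cd_inj N N2 (true, false) (false, false)).
Qed.

(** If [x] is in two first-level cells, some cell [i0] meets both sides, for otherwise the digits
    whose cells meet [A] form a pinch. Such a cell contains [x], and pulling back to it raises the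
    rank. If [x] is in one first-level cell only, both sides reach that cell, and the induction
    continues there without loss of rank. *)
Lemma nonsimple_rank m x A w u : ~ fragile -> separation x A -> size w = m -> size u = m ->
  inD w -> inD u -> cell w x -> cell u x -> w <> u ->
  exists x' A', separation x' A' /\ (rank x < rank x')%N.
Proof.
move=> nf; elim: m x A w u => [|m IH] x A [|i w] [|j u] //= sA [sw] [su]
  /andP[iD wD] /andP[jD uD] wx ux wu.
have [Fx AF [a Aa] [b Bb] cA] := sA.
have [[i1 [j1 [y1 [z1 [i1D j1D ij1 [Fy1 Fz1 xy1 xz1]]]]]]|one] :=
  pselect (exists i j y z, [/\ i \in D, j \in D, i <> j &
    [/\ F y, F z, x = phi i y & x = phi j z]]).
  have [i0 [i0D [p [Fp Ap]] [q [Fq Bq]]]] : exists i0, [/\ i0 \in D,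
      exists p, F p /\ A (phi i0 p) & exists q, F q /\ coside x A (phi i0 q)].
    apply: contrapT => no; apply: nf.
    pose I : {set digit N} := [set l in D | `[< exists y, F y /\ A (phi l y) >]]%SET.
    exists I, x; split.
    - by apply/fintype.subsetP => l; rewrite inE => /andP[].
    - have [/F_decomp[l [y [lD Fy ay]]] _] := AF _ Aa.
      by apply/finset.set0Pn; exists l; rewrite inE lD; apply/asboolP; exists y; rewrite -ay.
    - have [/F_decomp[l [y [lD Fy by_]]] bx nAb] := Bb.
      apply: contra_notN no => /eqP ID; exists l; split=> //.
        by move: lD; rewrite -ID inE => /andP[_ /asboolP].
      by exists y; rewrite -by_.
    - move=> i2 j2 y z i2I j2D j2I Fy Fz e; apply: contrapT => yx.
      move: i2I; rewrite inE => /andP[i2D /asboolP[p [Fp Ap]]].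
      have [Ay|nAy] := pselect (A (phi i2 y)).
        by case/negP: j2I; rewrite inE j2D; apply/asboolP; exists z; rewrite -e.
      apply: no; exists i2; split=> //; first by exists p.
      by exists y; split=> //; split=> //; exact: F_phi.
  have [x0 [Fx0 xE]] : exists x0, F x0 /\ x = phi i0 x0.
    apply: contrapT => no; have nx : ~ cell [:: i0] x by move/cell1P.
    case: Bq => _ _; apply.
    by apply: (separation_sub sA _ nx _ _ Ap); rewrite ?cell1 //= i0D.
  rewrite xE in sA Bq xy1 xz1 *; exists x0, (pull i0 A); split.
    by apply: (separation_pull i0D Fx0 sA); [exists p|exists q].
  have [e|ne] := eqVneq i0 i1; last by move/eqP: ne => ne; exact: (rank_touch ne Fx0 Fy1 xy1).
  have ne : i0 <> j1 by rewrite e.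
  exact: (rank_touch ne Fx0 Fz1 xz1).
have [x1 wx1 xE] := (iffLR (cell_consE i w x)) wx.
have [z1 uz1 xE'] := (iffLR (cell_consE j u x)) ux.
have Fx1 := cell_sub wD wx1; have Fz1 := cell_sub uD uz1.
have ij : i = j by apply: contrapT => ij; apply: one; exists i, j, x1, z1.
subst x j; have e := phi_inj N2 xE'; subst z1.
have only l : l \in D -> cell [:: l] (phi i x1) -> l = i.
  move=> lD /cell1P[y [Fy e]]; apply: contrapT => li.
  by apply: one; exists l, i, y, x1.
have sA1 : separation x1 (pull i A).
  apply: separation_pull => //; first exact: (separation_near sA iD only).
  have [y [Fy By]] := separation_near (separation_coside sA) iD only.
  by exists y.
have [|x' [A' [sA' rk]]] := IH x1 (pull i A) w u sA1 sw su wD uD wx1 uz1.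
  by move=> e; apply: wu; rewrite e.
by exists x', A'; split=> //; apply: leq_ltn_trans rk; exact: rank_phi.
Qed.

Lemma simple_separation x A : ~ fragile -> separation x A ->
  exists x' A', separation x' A' /\ simple x'.
Proof.
move=> nf; have [m] := ubnP (2 - rank x)%N.
elim: m x A => // m IH x A hm sA.
have [sx|nsx] := pselect (simple x); first by exists x, A.
move/existsNP: nsx => [w /existsNP[u]].
move=> /not_implyP[sz /not_implyP[wD /not_implyP[uD /not_implyP[wx /not_implyP[ux wu]]]]].
have [x' [A' [sA' rk]]] := nonsimple_rank nf sA sz erefl wD uD wx ux wu.
have : (rank x' <= 2)%N by rewrite /rank; case: (on_edge _ _); case: (on_edge _ _).
move=> r2; apply: (IH x' A') => //; nat_lia.
Qed.

(** * Carpets without pinch points *)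

Definition Fr f g (a b : R) := exists z, [/\ F z, co f z = a & co g z = b].

Definition Dg f g (a b : nat) := exists i, [/\ i \in D, cd f i = a & cd g i = b].

Lemma Dg_lt f g a b : Dg f g a b -> (a < N)%N /\ (b < N)%N.
Proof. by move=> [i [_ <- <-]]; rewrite !cd_lt. Qed.

Lemma Fr_range f g a b : Fr f g a b -> 0 <= a <= 1 /\ 0 <= b <= 1.
Proof. by move=> [z [Fz <- <-]]; rewrite !F01. Qed.

Lemma Fr_out f g m n a b : Dg f g m n -> Fr f g a b ->
  Fr f g ((a + m%:R) / N%:R) ((b + n%:R) / N%:R).
Proof.
move=> [l [lD <- <-]] [z [Fz <- <-]]; exists (phi l z); rewrite !coE //; split=> //.
exact: F_phi.
Qed.

Lemma Fr_in f g a b : Fr f g a b ->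
  exists m n, Dg f g m n /\ Fr f g (N%:R * a - m%:R) (N%:R * b - n%:R).
Proof.
have n0 := natN_neq0 R N2.
move=> [z [/F_decomp[l [y [lD Fy ->]]] <- <-]].
exists (cd f l), (cd g l); split; first by exists l.
by exists y; split=> //; rewrite coE //; field.
Qed.

Lemma Fr_fix f g m n : Dg f g m n -> Fr f g (m%:R / (N%:R - 1)) (n%:R / (N%:R - 1)).
Proof.
by move=> [l [lD <- <-]]; exists (fixpt R l); rewrite !co_fixpt //; split=> //; exact: fixpt_in.
Qed.

Lemma Fr_swap f g a b : Fr f g a b -> Fr g f b a.
Proof. by move=> [z [? ? ?]]; exists z. Qed.

Definition other f : frame := (~~ f.1, false).

Lemma otherP f : f.1 != (other f).1.
Proof. by case: f => [[] s]. Qed.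

Lemma frame_cases f g : f.1 = g.1 -> g = f \/ g = flip f.
Proof. by case: f g => [[] []] [[] []] //= _; (by left) || by right. Qed.

Lemma cd_axis f g i j : f.1 = g.1 -> cd f i = cd f j -> cd g i = cd g j.
Proof. by move=> /frame_cases[] -> //; rewrite !cd_flip // => ->. Qed.

Lemma same_axis f g (h : frame) : f.1 != g.1 -> f.1 != h.1 -> g.1 = h.1.
Proof. by case: f g h => [[] ?] [[] ?] [[] ?]. Qed.

Lemma cd_edge0 f (v : digit N) p : F p -> co f (phi v p) = 0 -> cd f v = 0%N.
Proof.
move=> Fp; have n0 := natN_neq0 R N2; rewrite coE // => h.
have e : co f p + (cd f v)%:R = 0 by rewrite -(divfK n0 (_ + _)) h mul0r.
by have [] := digit_eq0 (F_ge0 f Fp) e.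
Qed.

Lemma cd_edge1 f (v : digit N) p : F p -> co f (phi v p) = 1 -> cd f v = N.-1.
Proof.
move=> Fp; have n0 := natN_neq0 R N2; rewrite coE // => h.
have e : co f p + (cd f v)%:R = N%:R by rewrite -[LHS](divfK n0) h mul1r.
have /andP[_ p1] := F01 f Fp.
by have [] := digit_eqN N2 p1 (cd_lt N2 f v) e.
Qed.

Definition two_links f g := exists b b' : R, [/\ Lk (Fr f g) b, Lk (Fr f g) b' & b <> b'].

(* In the frame [f], all the points through which a cell can meet a left neighbour
   lie in its subcell [v]. The last clause provides two such points unless [v] is a
   corner digit where [r] may have neighbours along the other axis too. *)
Definition leftward (r : digit N) f (v : digit N) :=
  [/\ v \in D, cd f v = 0%N & forall g, f.1 != g.1 ->
  [/\ exists i, [/\ i \in D, cd f i = N.-1 & cd g i = cd g v],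
      forall y z, F y -> F z -> co f y = 0 -> co f z = 1 -> co g y = co g z ->
        exists p, F p /\ y = phi v p &
      (0 < cd g v)%N || (cd g r == 0%N) -> (cd g v < N.-1)%N || (cd g r == N.-1) ->
        two_links f g]].

(** With a single point of contact, [[set r]] would be a pinch. *)
Lemma two_neighbour_links r : ~ fragile -> r \in D ->
  exists y1 y2, y1 <> y2 /\ forall y, y = y1 \/ y = y2 -> F y /\
    exists j z, [/\ j \in D, j != r, F z & phi r y = phi j z].
Proof.
move=> nf rD.
have ex c : exists y, [/\ y <> c, F y &
    exists j z, [/\ j \in D, j != r, F z & phi r y = phi j z]].
  apply: contrapT => no; apply: nf; exists [set r]%SET, (phi r c); split.
  - by rewrite finset.sub1set.
  - by apply/finset.set0Pn; exists r; rewrite inE.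
  - by apply: contraTneq D2 => <-; rewrite cards1.
  - move=> i j y z; rewrite !inE => /eqP -> jD jr Fy Fz e; congr phi.
    by apply: contrapT => yc; apply: no; exists y; split=> //; exists j, z.
have [y1 [_ Fy1 h1]] := ex 0; have [y2 [y21 Fy2 h2]] := ex y1.
exists y1, y2; split; first by move=> e; apply: y21.
by move=> y [->|->].
Qed.

(** All contacts of [r] lie in its subcell [v]. Some neighbour shares an edge with [r]: otherwise
    two different contacts would be corners of the unit square, and one subcell contains at most one
    of them. The frame [f] is chosen so that this neighbour lies to the left. *)
Lemma attached_leftward r x B v : ~ fragile -> Attached r x B v ->
  exists f i, [/\ i \in D, cd f r = (cd f i).+1, cd (other f) i = cd (other f) r,
    leftward r f v & B (fixpt R v) /\ forall y z, F y -> F z -> co f y = 0 -> co f z = 1 ->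
      co (other f) y = co (other f) z -> B y].
Proof.
move=> nf [sB sx [rD vD vx] smB links].
have n2 := natN_ge2 R N2; have n0 := natN_neq0 R N2.
have inv y : B y -> exists p, F p /\ y = phi v p.
  have [_ BF _ _ _] := sB => By; have [/F_decomp[i [p [iD Fp e]]] _] := BF _ By.
  have [iv|iv] := eqVneq i v; first by exists p; rewrite -iv.
  by case: (smB i p iD iv Fp); rewrite -e.
have [y1 [y2 [y12 lk]]] := two_neighbour_links nf rD.
have linkB y : y = y1 \/ y = y2 -> B y.
  by move=> /lk[Fy [j [z [jD jr Fz e]]]]; exact: links e.
have [y [j [z [f0 [Fy Fz jD jr [e nf0 eg0]]]]]] :
   exists y j z f, [/\ F y, F z, j \in D, j != r &
     [/\ phi r y = phi j z, cd f j <> cd f r & cd (other f) j = cd (other f) r]].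
  apply: contrapT => no.
  have corner y f : y = y1 \/ y = y2 -> co f y = 0 \/ co f y = 1.
    move=> /lk[Fy [j [z [jD jr Fz e]]]].
    have [[ec _]|[_ -> _]|[_ -> _]] := touch_cases f Fy Fz e; [|by left|by right].
    case: no; exists y, j, z, (other f); split=> //; split=> //.
      move=> ec'; case/eqP: jr.
      by apply: (@cd_inj N N2 _ _ _ _ (otherP f)); rewrite ?ec ?ec'.
    apply: (@cd_axis f) => //; by case: (f) => [[] s].
  have same f : co f y1 = co f y2.
    have [p1 [Fp1 e1]] := inv _ (linkB y1 (or_introl erefl)).
    have [p2 [Fp2 e2]] := inv _ (linkB y2 (or_intror erefl)).
    case: (corner y1 f (or_introl erefl)) (corner y2 f (or_intror erefl)) => h1 [h2|h2];
      rewrite h1 h2 //; exfalso.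
      rewrite e1 in h1; rewrite e2 in h2.
      have := cd_edge0 Fp1 h1; rewrite (cd_edge1 Fp2 h2); nat_lia.
    rewrite e1 in h1; rewrite e2 in h2.
    have := cd_edge0 Fp2 h2; rewrite (cd_edge1 Fp1 h1); nat_lia.
  by apply: y12; apply: (@co_inj _ (true, false) (false, false)).
have [f [ef rf]] : exists f, f.1 = f0.1 /\ cd f r = (cd f j).+1.
  have [[]|[h _ _]|[h _ _]] := touch_cases f0 Fy Fz e; first by move/esym.
    by exists f0.
  exists (flip f0); split=> //; rewrite !cd_flip //.
  have := cd_lt N2 f0 j; nat_lia.
have eg g : f.1 != g.1 -> cd g j = cd g r.
  move=> fg; apply: (@cd_axis (other f0)) => //.
  by apply: (@same_axis f) => //; rewrite ef; exact: otherP.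
have [y0 z1] : co f y = 0 /\ co f z = 1.
  have [[h _]|[_ -> ->] //|[h _ _]] := touch_cases f Fy Fz e; exfalso; nat_lia.
have yzg g : f.1 != g.1 -> co g y = co g z.
  move=> fg; have [[_ ->] //|[h _ _]|[h _ _]] := touch_cases g Fy Fz e; exfalso;
    move: h; rewrite eg //; nat_lia.
have linkB' g y' z' : f.1 != g.1 -> F y' -> F z' -> co f y' = 0 -> co f z' = 1 ->
    co g y' = co g z' -> B y'.
  move=> fg Fy' Fz' h0 h1 hg; apply: (links j y' z') => //.
  apply: (touch_intro fg); last by rewrite hg eg.
  by rewrite h0 h1 rf -natr1; lra.
have fv : cd f v = 0%N.
  have [p [Fp yE]] := inv _ (linkB' _ _ _ (otherP f) Fy Fz y0 z1 (yzg _ (otherP f))).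
  by apply: (cd_edge0 Fp); rewrite -yE.
(* The two conditions exclude contacts across the lower and upper edges: such a contact would place
   [v] at an edge where [r] has no room for a neighbour. *)
have two g : f.1 != g.1 -> (0 < cd g v)%N || (cd g r == 0%N) ->
    (cd g v < N.-1)%N || (cd g r == N.-1) -> two_links f g.
  move=> fg hv0 hv1.
  have L y' : y' = y1 \/ y' = y2 -> co f y' = 0 /\ Lk (Fr f g) (co g y').
    move=> hy'; have [Fy' [j' [z' [j'D j'r Fz' e']]]] := lk _ hy'.
    have [p [Fp y'E]] := inv _ (linkB _ hy').
    have ej' : cd g j' = cd g r /\ co g y' = co g z'.
      have [[-> ->] //|[h h0 _]|[h h1 _]] := touch_cases g Fy' Fz' e'; exfalso.
        have := cd_edge0 (f := g) (v := v) Fp; rewrite -y'E => /(_ h0) hv.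
        by move: hv0; rewrite hv h.
      have := cd_edge1 (f := g) (v := v) Fp; rewrite -y'E => /(_ h1) hv.
      move: hv1; rewrite hv ltnn /= => /eqP hr; have := cd_lt N2 g j'; nat_lia.
    have [[h _]|[_ h0 h1]|[_ h1 _]] := touch_cases f Fy' Fz' e'.
    - case/eqP: j'r; apply: (@cd_inj N N2 _ _ _ _ fg); [exact: esym|by case: ej'].
    - split=> //; split; first by exists y'.
      by exists z'; split=> //; case: ej'.
    - exfalso; have := cd_edge1 (f := f) (v := v) Fp; rewrite -y'E => /(_ h1); nat_lia.
  have [a1 L1] := L y1 (or_introl erefl); have [a2 L2] := L y2 (or_intror erefl).
  exists (co g y1), (co g y2); split=> // c12.
  by apply: y12; apply: (co_inj fg); rewrite ?a1 ?a2.
have lw : leftward r f v.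
  split=> // g fg.
  have hL y' z' : F y' -> F z' -> co f y' = 0 -> co f z' = 1 -> co g y' = co g z' ->
      exists p, F p /\ y' = phi v p.
    by move=> ? ? ? ? ?; apply: inv; apply: (linkB' g y' z').
  split=> //; last by apply: two.
  have Dv : Dg f g 0 (cd g v) by exists v.
  have [|||i [iD e1 e2]] := @opposite_digit R N (Fr f g) (Dg f g) N2 (@Dg_lt f g) (@Fr_range f g)
     (@Fr_in f g) (cd g v) (co g y) Dv.
  - move=> b [[y' [Fy' h0 hb]] [z' [Fz' h1 hb']]].
    have [|p [Fp y'E]] := hL y' z' Fy' Fz' h0 h1; first by rewrite hb hb'.
    exists p; split=> //.
      by move: h0; rewrite y'E coE // fv addr0 => /(canRL (divfK n0)); rewrite mul0r.
    by rewrite -hb y'E coE //; field.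
  - split; first by exists y.
    by exists z; split=> //; rewrite yzg.
  - by move=> /andP[a b]; apply: two; rewrite ?a ?b.
  - by exists i.
exists f, j; split=> //; first by apply: eg; exact: otherP.
split; last by move=> y' z' ? ? ? ? ?; apply: (linkB' (other f) y' z') => //; exact: otherP.
(* The fixed points of [v] and of its opposite digit face each other on the left and right edges, so
   the former is a point of contact. *)
have [_ _ /(_ _ (otherP f))[[i [iD i1 i2]] _ _]] := lw.
apply: (linkB' (other f) _ (fixpt R i) (otherP f)); rewrite ?co_fixpt //.
- exact: fixpt_in.
- exact: fixpt_in.
- by rewrite fv mul0r.
- by rewrite i1 divN1.
- by rewrite i2.
Qed.

(** Two successive attachments cannot use different axes: this is [no_corner_turn] for the row
    [cd f' i] and the column [cd f v']. *)
Lemma leftward_no_turn r f v f' v' i : leftward r f v -> leftward v f' v' -> f.1 != f'.1 ->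
  i \in D -> cd f' v = (cd f' i).+1 -> cd f i = cd f v -> False.
Proof.
have n0 := natN_neq0 R N2.
move=> [vD fv lw] [v'D f'v' lw'] ff' iD e1 e2.
have [[vb [vbD vb1 vb2]] hL h2] := lw _ ff'.
have f'f : f'.1 != f.1 by rewrite eq_sym.
have [[vb' [vb'D vb'1 vb'2]] hV h2V] := lw' _ f'f.
apply: (@no_corner_turn R N (Fr f f') (Dg f f') N2 (@Dg_lt f f') (@Fr_range f f')
  (@Fr_out f f') (@Fr_in f f') (@Fr_fix f f') (cd f' i) (cd f v')).
- by exists v; rewrite fv e1.
- by exists vb; rewrite vb1 vb2 e1.
- by exists i; rewrite e2 fv.
- move=> b [[y [Fy h0 hb]] [z [Fz h1 hb']]].
  have [|p [Fp yE]] := hL y z Fy Fz h0 h1; first by rewrite hb hb'.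
  exists p; split=> //.
    by move: h0; rewrite yE coE // fv addr0 => /(canRL (divfK n0)); rewrite mul0r.
  by rewrite -hb yE coE // e1; field.
- move=> hr; apply: h2; rewrite e1 ?hr //.
- by exists v'.
- by exists vb'.
- move=> b [[y [Fy hb h0]] [z [Fz hb' h1]]].
  have [|p [Fp yE]] := hV y z Fy Fz h0 h1; first by rewrite hb hb'.
  exists p; split=> //; last first.
    by move: h0; rewrite yE coE // f'v' addr0 => /(canRL (divfK n0)); rewrite mul0r.
  by rewrite -hb yE coE //; field.
- move=> hs; have [||y [y' [[a1 a2] [b1 b2] ne]]] := h2V; rewrite ?hs ?fv ?eqxx ?orbT //.
  by exists y, y'; split=> //; split; apply: Fr_swap.
Qed.

(** With all digits in one row, the coordinate across it obeys a single expansion and is constant on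
    [F]. *)
Lemma single_row f g rho b b' : f.1 != g.1 -> (forall i, i \in D -> cd g i = rho) ->
  Lk (Fr f g) b -> Lk (Fr f g) b' -> b = b'.
Proof.
move=> fg row [[y [Fy _ yb]] _] [[y' [Fy' _ yb']] _].
apply: (@expansion_eq R N N2 (fun c => exists z, F z /\ co g z = c) rho%:R).
- by move=> c [z [Fz <-]]; exact: F01.
- move=> c [z [/F_decomp[i [z' [iD Fz' ->]]] <-]]; exists z'; split=> //.
  rewrite coE // row //; have n0 := natN_neq0 R N2; by field.
- by exists y.
- by exists y'.
Qed.

(** A short tail produces three successive attachments, of [r], [v] and [v2]. Their directions
    alternate, which forces [v2] to be the digit [vb] opposite to [v] and [v3 = v]. Then [vb] has
    only one neighbour [u], and deleting the cell of [x2] inside [u] cuts [vb] off. *)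
Lemma nonfragile_tail k x A : ~ fragile -> separation x A -> simple x -> long_tail k.
Proof.
move=> nf sA0 sx0; apply: contrapT => nk.
have n2 := natN_ge2 R N2.
have [r [x1 [B1 [v C1]]]] : exists r x' B v, Attached r x' B v.
  have [Fx0 _ _ _ _] := sA0.
  have [v0 [y0 [v0D Fy0 x0E]]] := F_decomp Fx0.
  have v0x : cell [:: v0] x by apply/cell1P; exists y0.
  have [sm|sm] := simple_small nk sA0 sx0 v0D v0x.
    by have [r [x' [B [v [C _]]]]] := descend nk sA0 sx0 v0D v0x sm; exists r, x', B, v.
  by have [r [x' [B [v [C _]]]]] := descend nk (separation_coside sA0) sx0 v0D v0x sm;
    exists r, x', B, v.
have next r0 x0 B0 v0 : Attached r0 x0 B0 v0 -> B0 (fixpt R v0) ->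
    exists x' B v', Attached v0 x' B v'.
  move=> [sB sx [_ vD vx] sm _] Bv.
  have [r' [x' [B [v' [C /(_ Bv)[e _]]]]]] := descend nk sB sx vD vx sm.
  by subst r'; exists x', B, v'.
have [f [i [iD _ _ lw [Bf1 _]]]] := attached_leftward nf C1.
have [x2 [B2 [v2 C2]]] := next _ _ _ _ C1 Bf1.
have [f2 [i2 [i2D r2 o2 lw2 [Bf2 right2]]]] := attached_leftward nf C2.
have [x3 [B3 [v3 C3]]] := next _ _ _ _ C2 Bf2.
have [f3 [i3 [i3D r3 o3 lw3 [Bf3 _]]]] := attached_leftward nf C3.
have opp r' f' v' f'' v'' i' : leftward r' f' v' -> leftward v' f'' v'' -> i' \in D ->
    cd f'' v' = (cd f'' i').+1 -> cd (other f'') i' = cd (other f'') v' -> f'' = flip f'.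
  move=> l1 l2 i'D e1 e2; have [ax|ax] := eqVneq f'.1 f''.1.
    have [ff|//] := frame_cases ax.
    by have [_ h _] := l1; rewrite ff h in e1.
  exfalso; apply: (leftward_no_turn l1 l2 ax i'D e1).
  apply: (@cd_axis (other f'')) => //.
  by apply: (same_axis (otherP f'')); rewrite eq_sym.
have ef2 := opp _ _ _ _ _ _ lw lw2 i2D r2 o2; subst f2.
have ef3 := opp _ _ _ _ _ _ lw2 lw3 i3D r3 o3; rewrite flipK in ef3; subst f3.
pose g := other f; have fg : f.1 != g.1 := otherP f.
have fg' : (flip f).1 != g.1 by exact: fg.
have [vD fv /(_ _ fg)[[vb [vbD vb1 vb2]] _ _]] := lw.
have [v2D fv2' /(_ _ fg')[_ in2 two2]] := lw2.
have [v3D fv3 /(_ _ fg)[_ in3 _]] := lw3.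
have fix0 : co f (fixpt R v) = 0 by rewrite co_fixpt // fv mul0r.
have fix1 : co f (fixpt R vb) = 1 by rewrite co_fixpt // vb1 divN1.
have fixg : co g (fixpt R vb) = co g (fixpt R v) by rewrite !co_fixpt // vb2.
have v2E : v2 = vb.
  have [||p [Fp e]] := in2 _ _ (fixpt_in vbD) (fixpt_in vD) _ _ fixg;
    rewrite ?co_flip ?fix0 ?fix1 ?subrr ?subr0 //.
  exact: (fixpt_only Fp (esym e)).
subst v2.
have v3E : v3 = v.
  have [p [Fp e]] := in3 _ _ (fixpt_in vD) (fixpt_in vbD) fix0 fix1 (esym fixg).
  exact: (fixpt_only Fp (esym e)).
subst v3.
rename i3 into u.
have ug : cd g u = cd g vb by exact: o3.
have insub x' r' B v' : Attached r' x' B v' -> forall y, B y -> exists p, F p /\ y = phi v' p.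
  move=> [[_ BF _ _ _] _ _ smB _] y By; have [/F_decomp[l [p [lD Fp e]]] _] := BF _ By.
  have [lv|lv] := eqVneq l v'; first by exists p; rewrite -lv.
  by case: (smB l p lD lv Fp); rewrite -e.
have edge_row (w : digit N) j y z : F y -> F z -> (exists p, F p /\ y = phi w p) ->
    forall l : digit N, phi l y = phi j z -> cd g l = cd g w -> cd g j = cd g l /\ co g y = co g z.
  move=> Fy Fz [p [Fp yE]] l e lw_; subst y.
  have [[-> ->] //|[h h0 _]|[h h1 _]] := touch_cases g Fy Fz e; exfalso.
    by move: h; rewrite lw_ (cd_edge0 Fp h0).
  by have := cd_lt N2 g j; rewrite h lw_ (cd_edge1 Fp h1); nat_lia.
have vbg : cd g vb = cd g v by [].
(* Contacts of [vb] lie in its subcell [v] on the left edge, hence involve only the left neighbour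
   [u]. *)
have only_nb j y z : j \in D -> j != vb -> F y -> F z -> phi vb y = phi j z ->
    [/\ j = u, co f y = 0, co f z = 1 & co g y = co g z].
  move=> jD jv Fy Fz e; have [_ _ _ _ links3] := C3.
  have inv := insub _ _ _ _ C3 _ (links3 j y z jD jv Fy Fz e).
  have [ej ey] := edge_row v j y z Fy Fz inv vb e vbg.
  have [p [Fp yE]] := inv; subst y.
  have [[h _]|[h h0 h1]|[_ h1 _]] := touch_cases f Fy Fz e.
  - by case/eqP: jv; apply: (cd_inj N2 fg).
  - split=> //; apply: (cd_inj N2 fg); last by rewrite ej ug.
    by move: h; rewrite r3 => -[].
  - exfalso; have := cd_edge1 Fp h1; rewrite fv; nat_lia.
have uvb : u != vb by apply: contra_eq_neq r3 => ->; nat_lia.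
(* A third digit supplies the second tail. If there were none, all digits would lie in one row,
   against the two contacts given by [two2]. *)
have [j [jD ju jvb]] : exists j, [/\ j \in D, j != u & j != vb].
  apply: contrapT => no.
  have row i' : i' \in D -> cd g i' = cd g v.
    move=> i'D; have [->|iu] := eqVneq i' u; first by rewrite ug.
    have [-> //|ib] := eqVneq i' vb; by case: no; exists i'.
  have [||b [b' [L1 L2 ne]]] := two2; [| |by apply: ne; apply: (single_row fg' row)].
    by rewrite vbg; case: posnP.
  rewrite vbg; have := cd_lt N2 g v; nat_lia.
have [sB2 sx2 [_ _ _] smB2 _] := C2.
have [Fx2 _ _ _ _] := sB2.
have [q [sq qD qx]] := cover k Fx2.
have inside t y : size t = k -> inD t -> t <> q -> cell t y -> B2 y -> cell t `<=` B2.
  move=> st tD tq ty By z tz; apply: (separation_sub sB2 tD _ ty tz By) => tx.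
  by apply: tq; apply: sx2 => //; rewrite st sq.
apply: nk; apply: leq_trans (leq_subr _ _) _.
(* The block of [vb], together with the cells in [u] on the side [B2] of the copy of [x2]. Since
   [B2] lies in the subcell [vb], this part of [u] meets no neighbour of [u] other than [vb]. *)
pose P (w : seq (digit N)) := if w is a :: t then a = vb \/ (a = u /\ cell t `<=` B2) else False.
apply: (@chi_full k u q vb j P) => //=.
- by rewrite i3D.
- by rewrite eq_sym.
- by move=> w _; left.
- by move=> w _ [/eqP|[/eqP]]; [rewrite (negPf jvb)|rewrite (negPf ju)].
move=> [|a t] [|b t'] // z0 [st] [st'] /andP[aD tD] /andP[bD t'D] wq uq Pw nPu.
move=> /cell_consE[y ty z0E] /cell_consE[z t'z]; rewrite z0E => e.
have Fy := cell_sub tD ty; have Fz := cell_sub t'D t'z.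
have bvb : b != vb by apply: contra_notN nPu => /eqP; left.
case: Pw => [av|[au tB]].
  subst a; have [bu y0 z1 eg] := only_nb b y z bD bvb Fy Fz e.
  apply: nPu; right; split=> //; apply: (inside _ z) => //.
    by move=> t'q; apply: uq; rewrite bu t'q.
  by apply: (right2 z y) => //; rewrite ?co_flip ?y0 ?z1 ?subrr ?subr0.
subst a; have By := tB _ ty.
have [bu|bu] := eqVneq b u.
  subst b; have yz := phi_inj N2 e; subst z.
  apply: nPu; right; split=> //; apply: (inside _ y) => //.
  by move=> t'q; apply: uq; rewrite t'q.
have inv := insub _ _ _ _ C2 _ By.
have [eg _] := edge_row vb b y z Fy Fz inv u e ug.
have [p [Fp yE]] := inv; subst y.
have [[h _]|[_ h0 _]|[h _ _]] := touch_cases f Fy Fz e.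
- by case/eqP: bu; apply: (cd_inj N2 fg).
- have := cd_edge0 Fp h0; rewrite vb1; nat_lia.
- case/eqP: bvb; apply: (cd_inj N2 fg); last by rewrite eg ug.
  by rewrite h r3.
Qed.

(** * Carpets with a pinch point *)

(* [single y z] says that [y] is the only point of [F] of the form [z' + (y - z)]
   with [z'] in [F], where [y - z] is a nonzero integer vector. *)
Definition single y z := [/\ F y, F z, y <> z,
  forall f, [\/ co f y = co f z, co f y = 0 /\ co f z = 1 | co f y = 1 /\ co f z = 0] &
  forall y' z', F y' -> F z' -> (forall f, co f y' - co f z' = co f y - co f z) -> y' = y].

Lemma diff_axis f g y z y' z' : f.1 = g.1 ->
  co f y' - co f z' = co f y - co f z -> co g y' - co g z' = co g y - co g z.
Proof. by move=> /frame_cases[] -> //; rewrite !co_flip => h; lra. Qed.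

(** If [y] were in two first-level cells that differ along [f], it would be off the edges along [f].
    One of these cells would then face the cell [l] of [z] across the square, and their fixed points
    would have the same difference as [y] and [z]. By uniqueness [y] is such a fixed point, at an
    end of its cell along [f], which contradicts the neighbouring digit. *)
Lemma single_digit y z p p' y1 y1' : single y z -> p \in D -> p' \in D -> F y1 -> F y1' ->
  y = phi p y1 -> y = phi p' y1' -> p = p'.
Proof.
move=> [Fy Fz yz T uniq] pD p'D Fy1 Fy1' yE yE'.
suff key f q q' w w' : q \in D -> q' \in D -> F w -> F w' -> y = phi q w -> y = phi q' w' ->
    cd f q' = (cd f q).+1 -> False.
  have h f : cd f p = cd f p'.
    have e : phi p y1 = phi p' y1' by rewrite -yE.
    have [[-> _] //|[h _ _]|[h _ _]] := touch_cases f Fy1 Fy1' e; exfalso.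
      by apply: (key f p' p y1' y1).
    by apply: (key f p p' y1 y1').
  exact: (@cd_inj N N2 (true, false) (false, false)).
move=> qD q'D Fw Fw' yq yq' hd.
have e : phi q w = phi q' w' by rewrite -yq.
have [w1 w0] : co f w = 1 /\ co f w' = 0.
  by have [[h _]|[h _ _]|[_ -> ->]] := touch_cases f Fw Fw' e; move=> //; exfalso; nat_lia.
have notedge : co f y = co f z.
  have [//|[y0 _]|[yy1 _]] := T f; exfalso.
    by rewrite yq' in y0; have := cd_edge0 Fw' y0; rewrite hd.
  by rewrite yq in yy1; have := cd_edge1 Fw yy1; have := cd_lt N2 f q'; rewrite hd => ? ?; nat_lia.
have [l [v [lD Fv zE]]] := F_decomp Fz.
have lq : cd f l = cd f q' \/ cd f l = cd f q.
  have : co f v + (cd f l)%:R = co f w' + (cd f q')%:R.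
    have n0 := natN_neq0 R N2.
    by move: notedge; rewrite zE yq' !coE // => /(mulIf (invr_neq0 n0)) ->.
  case/(touch1 (F01 f Fv) (F01 f Fw')) => [[-> _]|[_ _]|[h _ _]]; first by left.
    by rewrite w0 => /eqP; rewrite eq_sym oner_eq0.
  by right; move: h; rewrite hd => -[].
pose g := other f; have fg : f.1 != g.1 := otherP f.
have side s u : F u -> y = phi s u -> cd f l = cd f s -> s \in D -> y = fixpt R s.
  move=> Fu ys ls sD; apply/esym/(uniq _ (fixpt R l)); [exact: fixpt_in|exact: fixpt_in|].
  have hf : co f (fixpt R s) - co f (fixpt R l) = co f y - co f z.
    by rewrite !co_fixpt // ls notedge !subrr.
  have hg : co g (fixpt R s) - co g (fixpt R l) = co g y - co g z.
    rewrite !co_fixpt //; have [yzg|[y0 z1]|[yy1 z0]] := T g.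
    - by case: yz; apply: (co_inj fg).
    - rewrite ys in y0 *; rewrite y0 z1 (cd_edge0 Fu y0).
      by rewrite zE in z1; rewrite (cd_edge1 Fv z1) divN1 // mul0r.
    - rewrite ys in yy1 *; rewrite yy1 z0 (cd_edge1 Fu yy1).
      by rewrite zE in z0; rewrite (cd_edge0 Fv z0) divN1 // mul0r.
  move=> h; have [fh|fh] := eqVneq f.1 h.1; first exact: (diff_axis fh hf).
  by apply: (diff_axis _ hg); apply: same_axis fh; rewrite fg.
case: lq => lq.
  have yf := side _ _ Fw' yq' lq q'D.
  have w'f : w' = fixpt R q'.
    by apply: (phi_inj N2 (i := q')); rewrite -yq' phi_fixpt.
  have := cd_edge0 (f := f) (v := q') (fixpt_in q'D); rewrite phi_fixpt // -w'f w0.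
  by move/(_ erefl); rewrite hd.
have yf := side _ _ Fw yq lq qD.
have wf : w = fixpt R q by apply: (phi_inj N2 (i := q)); rewrite -yq phi_fixpt.
have := cd_edge1 (f := f) (v := q) (fixpt_in qD); rewrite phi_fixpt // -wf w1.
by move/(_ erefl); have := cd_lt N2 f q'; rewrite hd => ? ?; nat_lia.
Qed.

Lemma single_descend p q y z : p \in D -> q \in D -> F y -> F z ->
  single (phi p y) (phi q z) -> single y z.
Proof.
move=> pD qD Fy Fz [_ _ yz T uniq]; have n0 := natN_neq0 R N2.
have T' f : [\/ co f y + (cd f p)%:R = co f z + (cd f q)%:R, co f y = 0 /\ co f z = 1
    | co f y = 1 /\ co f z = 0].
  have /andP[y0 y1] := F01 f Fy; have /andP[z0 z1] := F01 f Fz.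
  have := T f; rewrite !coE // => -[/(mulIf (invr_neq0 n0)) e|[e1 e2]|[e1 e2]].
  - by constructor 1.
  - constructor 2; split.
      have e : co f y + (cd f p)%:R = 0 by rewrite -(divfK n0 (_ + _)) e1 mul0r.
      by have [] := digit_eq0 y0 e.
    have e : co f z + (cd f q)%:R = N%:R by rewrite -[LHS](divfK n0) e2 mul1r.
    by have [] := digit_eqN N2 z1 (cd_lt N2 f q) e.
  - constructor 3; split.
      have e : co f y + (cd f p)%:R = N%:R by rewrite -[LHS](divfK n0) e1 mul1r.
      by have [] := digit_eqN N2 y1 (cd_lt N2 f p) e.
    have e : co f z + (cd f q)%:R = 0 by rewrite -(divfK n0 (_ + _)) e2 mul0r.
    by have [] := digit_eq0 z0 e.
split=> //.
- move=> eyz; apply: yz; subst z.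
  have h f : co f (phi p y) = co f (phi q y).
    have [e|[e1 e2]|[e1 e2]] := T' f; [|lra|lra].
    by rewrite !coE // e.
  exact: (@co_inj _ (true, false) (false, false)).
- move=> f; have [/(touch1 (F01 f Fy) (F01 f Fz))|h|h] := T' f;
    [|by constructor 2|by constructor 3].
  by case=> [[_ ->]|[_ ? ?]|[_ ? ?]]; [constructor 1|constructor 2|constructor 3].
- move=> y' z' Fy' Fz' h; apply: (phi_inj N2 (i := p)).
  apply: (uniq _ (phi q z')); [exact: F_phi|exact: F_phi|].
  by move=> f; rewrite !coE // -!mulrBl; congr (_ * _); have := h f; lra.
Qed.

(** The first digit of [y] is unique by [single_digit]; inside the first-level cells of [y] and [z]
    the pair is again single. *)
Lemma single_simple y z : single y z -> simple y.
Proof.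
move=> syz w; elim: w y z syz => [|p w IH] y z syz [|p' u] //= [sz] /andP[pD wD] /andP[p'D uD].
move=> /cell_consE[y1 wy1 yE] /cell_consE[y1' uy1' yE'].
have Fy1 := cell_sub wD wy1; have Fy1' := cell_sub uD uy1'.
have pp' := single_digit syz pD p'D Fy1 Fy1' yE yE'; subst p'.
rewrite yE in yE'; have e := phi_inj N2 yE'; subst y1'.
have [_ Fz _ _ _] := syz; have [q [z1 [qD Fz1 zE]]] := F_decomp Fz.
rewrite yE zE in syz; have syz1 := single_descend pD qD Fy1 Fz1 syz.
by rewrite (IH y1 z1 syz1 u).
Qed.

Definition touches i j := exists y z, [/\ F y, F z & phi i y = phi j z].

Lemma touches_sym i j : touches i j -> touches j i.
Proof. by move=> [y [z [? ? ?]]]; exists z, y. Qed.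

Lemma pinch_compl (I : {set digit N}) x : pinch I x -> pinch (D :\: I)%SET x.
Proof.
move=> [ID I0 InD h]; split.
- exact: finset.subsetDl.
- by rewrite finset.setD_eq0; apply: contra InD => DI; rewrite finset.eqEsubset ID DI.
- apply: contra I0 => /eqP E; rewrite -finset.subset0; apply/fintype.subsetP => i iI.
  by have := fintype.subsetP ID _ iI; rewrite -E inE iI.
- move=> i j y z; rewrite !inE => /andP[iI iD] jD; rewrite jD andbT negbK => jI Fy Fz e.
  by rewrite e; apply: (h j i z y) => //; rewrite e.
Qed.

Lemma pinch_single (I : {set digit N}) x i j y z : pinch I x -> i \in I -> j \in D -> j \notin I ->
  F y -> F z -> phi i y = phi j z ->
  single y z /\ forall y' z', F y' -> F z' -> phi i y' = phi j z' -> y' = y.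
Proof.
move=> [ID _ _ h] iI jD jI Fy Fz e.
have u y' z' : F y' -> F z' -> phi i y' = phi j z' -> y' = y.
  move=> Fy' Fz' e'; apply: (phi_inj N2 (i := i)).
  by rewrite (h i j y' z') // (h i j y z).
split=> //; split=> //.
- move=> yz; case/negP: jI; suff <- : i = j by [].
  subst z; have c f : cd f i = cd f j.
    by have := touchE f e => /addrI/eqP; rewrite eqr_nat => /eqP.
  exact: (@cd_inj N N2 (true, false) (false, false)).
- move=> f; have [[_ ?]|[_ ? ?]|[_ ? ?]] := touch_cases f Fy Fz e;
  by [constructor 1|constructor 2|constructor 3].
- move=> y' z' Fy' Fz' hd; apply: (u y' z') => //.
  have hf f : co f y' + (cd f i)%:R = co f z' + (cd f j)%:R.
    by have := hd f; have := touchE f e; lra.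
  exact: (@touch_intro (true, false) (false, false)).
Qed.

Lemma pinch_contact (I : {set digit N}) x : pinch I x ->
  exists i j y z, [/\ i \in I, j \in D, j \notin I & [/\ F y, F z & phi i y = phi j z]].
Proof. by move=> [ID I0 InD _]; exact: linkD. Qed.

Definition holds x i := exists y, F y /\ x = phi i y.

(** The deleted word is the cell of [x] in [i]. Every contact between the classes is at [x], hence
    uses this cell, and the full blocks of [i2] and [j] remain. *)
Lemma tail_of_unique_holder k (I : {set digit N}) x i i2 j y z :
  pinch I x -> i \in I -> j \in D -> j \notin I -> F y -> F z ->
  phi i y = phi j z -> (forall l, l \in I -> holds x l -> l = i) ->
  i2 \in I -> i2 != i -> long_tail k.
Proof.
move=> pI iI jD jI Fy Fz e only i2I i2i.
have [sg _] := pinch_single pI iI jD jI Fy Fz e.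
have sy := single_simple sg; have [ID _ _ h] := pI.
have iD := fintype.subsetP ID _ iI.
have [q [sq qD qy]] := cover k Fy.
apply: leq_trans (leq_subr _ _) _.
apply: (@chi_full k i q i2 j (fun w => if w is a :: _ then a \in I else False)) => //=.
- by rewrite iD.
- exact: (fintype.subsetP ID).
- by rewrite eq_sym.
- by apply: contraNneq jI => <-.
- by move=> _ _; apply/negP.
move=> [|a t] [|b t'] // p [st] [st'] /andP[aD tD] /andP[bD t'D] wq uq aI /negP bI.
move=> /cell_consE[y' ty' pE] /cell_consE[z' tz' pE'].
have Fy' := cell_sub tD ty'; have Fz' := cell_sub t'D tz'.
have e' : phi a y' = phi b z' by rewrite -pE.
have hx := h a b y' z' aI bD bI Fy' Fz' e'.
have ai : a = i by apply: only => //; exists y'; rewrite hx.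
subst a; apply: wq; congr cons; apply: sy => //; first by rewrite st sq.
suff <- : y' = y by [].
by apply: (phi_inj N2 (i := i)); rewrite hx (h i j y z).
Qed.

Lemma edge_frame b i j y z : F y -> F z -> phi i y = phi j z ->
  cd (b, false) i <> cd (b, false) j ->
  exists f : frame, f.1 = b /\ co f y = 0.
Proof.
move=> Fy Fz e ne; have [[//]|[_ h _]|[_ h _]] := touch_cases (b, false) Fy Fz e.
  by exists (b, false).
by exists (flip (b, false)); rewrite co_flip h subrr.
Qed.

(** If both neighbours had the digit of [i] along one axis, they would lie on opposite sides of [i]
    along the other, but [y] is not on two opposite edges. So [y] is on an edge along each axis, and
    reflections move it to the origin. *)
Lemma corner_frame i j1 j2 y z1 z2 : j1 <> i -> j2 <> i -> j1 <> j2 -> F y -> F z1 -> F z2 ->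
  phi i y = phi j1 z1 -> phi i y = phi j2 z2 ->
  exists f g, [/\ f.1 != g.1, co f y = 0 & co g y = 0].
Proof.
move=> j1i j2i j12 Fy Fz1 Fz2 e1 e2.
have ax b : exists f : frame, f.1 = b /\ co f y = 0.
  have [c1|c1] := eqVneq (cd (b, false) i) (cd (b, false) j1); last first.
    by apply: (edge_frame Fy Fz1 e1); apply/eqP.
  have [c2|c2] := eqVneq (cd (b, false) i) (cd (b, false) j2); last first.
    by apply: (edge_frame Fy Fz2 e2); apply/eqP.
  have bb : (b, false).1 != (~~ b, false).1 :> bool by case: b {c1 c2}.
  have inj l : cd (b, false) i = cd (b, false) l ->
      cd (~~ b, false) i = cd (~~ b, false) l -> l = i.
    by move=> a a'; apply/esym/(cd_inj N2 bb).
  exfalso; have [[h _]|[h y0 _]|[h yy1 _]] := touch_cases (~~ b, false) Fy Fz1 e1;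
  have [[h' _]|[h' y0' _]|[h' yy1' _]] := touch_cases (~~ b, false) Fy Fz2 e2;
    try (by apply: j1i; apply: inj); try (by apply: j2i; apply: inj).
  - by apply: j12; apply: (cd_inj N2 bb); [rewrite -c1 -c2|move: h; rewrite h' => -[]].
  - by move/eqP: yy1'; rewrite y0 eq_sym oner_eq0.
  - by move/eqP: yy1; rewrite y0' eq_sym oner_eq0.
  - by apply: j12; apply: (cd_inj N2 bb); [rewrite -c1 -c2|rewrite h h'].
have [f [f1 fy]] := ax true; have [g [g1 gy]] := ax false.
by exists f, g; rewrite f1 g1.
Qed.

Lemma contact_type f i j y z : F y -> F z -> phi i y = phi j z -> co f y = 0 ->
  (cd f i = cd f j /\ co f z = 0) \/ (cd f i = (cd f j).+1 /\ co f z = 1).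
Proof.
move=> Fy Fz e y0; have [[h h']|[h _ h']|[_ h _]] := touch_cases f Fy Fz e.
- by left; rewrite -h' y0.
- by right.
- by move/eqP: h; rewrite y0 eq_sym oner_eq0.
Qed.

(* These conditions ensure that removing the cell of the word [c ... c] from any level
   of the carpet leaves a connected set. *)
Definition nice_corner c := [/\ c \in D,
  forall a, a \in D -> a != c -> exists2 f, cd f c = 0%N & cd f a <> 0%N &
  forall a b, a \in D -> b \in D -> a != c -> b != c -> a != b ->
    touches c a -> touches c b -> touches a b].

(** In these frames [y] is [(0, 0)], [z1] is [(1, 0)], and [z2] is [(0, 1)] or [(1, 1)]. The
    uniqueness of the contacts makes 0 the only horizontal contact and, in the first case, the only
    vertical one, as [corner_neighbours] requires. *)
Lemma nice_corner_of_contacts f g i j1 j2 y z1 z2 : f.1 != g.1 -> co f y = 0 -> co g y = 0 ->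
  F y -> F z1 -> F z2 -> phi i y = phi j1 z1 -> phi i y = phi j2 z2 ->
  (forall y' z', F y' -> F z' -> phi i y' = phi j1 z' -> y' = y) ->
  (forall y' z', F y' -> F z' -> phi i y' = phi j2 z' -> y' = y) ->
  co f z1 = 1 /\ co g z1 = 0 -> co g z2 = 1 ->
  exists c, nice_corner c /\ fixpt R c = y.
Proof.
move=> fg yf yg Fy Fz1 Fz2 e1 e2 u1 u2 [z1f z1g] z2g.
have n1 := natN1_neq0 R N2.
have t1 := touchE f e1; have t1' := touchE g e1.
have t2 := touchE f e2; have t2' := touchE g e2.
have f00 : Fr f g 0 0 by exists y.
have f10 : Fr f g 1 0 by exists z1.
have [c [cD c0 c0']] : Dg f g 0 0.
  exact: (Dg00 (@Fr_range f g) (@Fr_in f g) f00).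
have L0 b : Lk (Fr f g) b -> b = 0.
  move=> [[p [Fp p0 pb]] [p' [Fp' p1 p'b]]].
  rewrite -pb -yg; congr co; apply: (u1 p p') => //; apply: (touch_intro fg); lra.
have V0 : Fr f g 0 1 /\ (forall b, Vk (Fr f g) b -> b = 0) \/ Fr f g 1 1.
  have [[_ z2f]|[_ z2f]] := contact_type Fy Fz2 e2 yf; [left|by right; exists z2].
  split; first by exists z2.
  move=> b [[p [Fp pb p0]] [p' [Fp' p'b p1]]].
  rewrite -pb -yf; congr co; apply: (u2 p p') => //; apply: (touch_intro fg); lra.
exists c; split; last by apply: (co_inj fg); rewrite co_fixpt // ?c0 ?c0' mul0r.
split=> //.
  move=> a aD ac; have [af|af] := eqVneq (cd f a) 0%N; last by exists f => //; apply/eqP.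
  by exists g => // ag; case/eqP: ac; apply: (cd_inj N2 fg); rewrite ?af ?ag.
have tch a b : touches a b <-> Tch (Fr f g) (cd f a) (cd g a) (cd f b) (cd g b).
  split=> [[p [p' [Fp Fp' e]]]|[u [v [u' [v' [[p [Fp pu pv]] [p' [Fp' pu' pv']] h h']]]]]].
    exists (co f p), (co g p), (co f p'), (co g p').
    by split; rewrite ?(touchE f e) ?(touchE g e) //; [exists p|exists p'].
  by exists p, p'; split=> //; apply: (touch_intro fg); rewrite ?pu ?pu' ?pv ?pv'.
have ne (a b : digit N) : a != b -> (cd f a, cd g a) <> (cd f b, cd g b).
  by move=> ab [h h']; case/eqP: ab; apply: (cd_inj N2 fg).
move=> a b aD bD ac bc ab /tch ta /tch tb; apply/tch.
rewrite c0 c0' in ta tb.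
apply: (corner_neighbours N2 (@Dg_lt f g) (@Fr_range f g) (@Fr_out f g) (@Fr_in f g)
  f00 f10 L0 V0) => //; try (by exists a); try (by exists b); try exact: ne.
- by rewrite -{1}c0 -{1}c0'; exact: ne.
- by rewrite -{1}c0 -{1}c0'; exact: ne.
Qed.

(** * Removing a corner cell *)

Definition off_corner c k : set (R * R) :=
  [set z | exists w, [/\ size w = k, inD w, w <> nseq k c & cell w z]].

Lemma linked_off_corner c (P : {set digit N}) : nice_corner c -> P \subset D :\ c ->
  P != finset.set0 -> P != (D :\ c)%SET ->
  exists i j, [/\ i \in P, j \in (D :\ c)%SET, j \notin P & touches i j].
Proof.
move=> [cD _ nb] PDc P0 PnDc; apply: contrapT => no.
have inP a : a \in P -> a \in D /\ a != c.
  by move=> /(fintype.subsetP PDc); rewrite !inE => /andP[].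
have apart a b : a \in P -> b \in D -> b != c -> b \notin P -> ~ touches a b.
  by move=> aP bD bc bP t; apply: no; exists a, b; rewrite !inE bc bD.
have [[a [aP ca]]|noP] := pselect (exists a, a \in P /\ touches c a); last first.
  have [||| a [b [y [z [aP bD bP h]]]]] := @linkD P.
  - by apply/fintype.subsetP => a /inP[].
  - exact: P0.
  - by apply: contraTneq cD => <-; apply/negP => /inP[_]; rewrite eqxx.
  have tab : touches a b by exists y, z.
  have [bc|bc] := eqVneq b c; last exact: (apart a b).
  by apply: noP; exists a; split=> //; apply: touches_sym; rewrite -bc.
have noQ b : b \in D -> b != c -> b \notin P -> ~ touches c b.
  move=> bD bc bP cb; have [aD ac] := inP _ aP; apply: (apart a b) => //.
  by apply: nb => //; apply: contraNneq bP => <-.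
have [||| a' [b [y [z [a'P bD bP h]]]]] := @linkD (c |: P)%SET.
- by apply/fintype.subsetP => b; rewrite !inE => /orP[/eqP->//|/inP[]].
- by apply/finset.set0Pn; exists c; rewrite !inE eqxx.
- apply: contra PnDc => /eqP E; rewrite finset.eqEsubset PDc /=.
  by apply/fintype.subsetP => b; rewrite -E !inE => /andP[/negPf->].
have t : touches a' b by exists y, z.
move: bP; rewrite !inE negb_or => /andP[bc bP].
move: a'P; rewrite !inE => /orP[/eqP e|a'P]; last exact: (apart a' b).
by apply: (noQ b) => //; rewrite -e.
Qed.

Lemma off_corner1 c : union (fun i => cell [:: i]) (D :\ c)%SET = off_corner c 1.
Proof.
apply/seteqP; split=> z.
  move=> [i]; rewrite !inE => /andP[ic iD] iz; exists [:: i]; rewrite /= iD; split=> //.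
  by case=> e; rewrite e eqxx in ic.
move=> [w [sw wD wc wz]]; case: w sw wD wc wz => [|i [|? ?]] //= _.
rewrite andbT => iD ic iz; exists i => //.
by rewrite !inE iD andbT; apply/eqP => e; apply: ic; rewrite e.
Qed.

Lemma off_cornerS c k : c \in D ->
  off_corner c k.+1 = phi c @` off_corner c k `|` off_corner c 1.
Proof.
move=> cD; apply/seteqP; split=> z.
  move=> [[|i w] [] // [sw] /andP[iD wD] ne /cell_consE[y wy ->]].
  have [ic|ic] := eqVneq i c.
    left; exists y; last by rewrite ic.
    by exists w; split=> // e; apply: ne; rewrite e ic.
  right; exists [:: i]; rewrite /= iD; split=> //; first by case=> e; rewrite e eqxx in ic.
  by apply/cell1; exact: cell_sub wy.
case=> [[y [w [sw wD ne wy]] <-]|].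
  exists (c :: w); rewrite /= sw cD; split=> //; first by case.
  exact/cell_phi.
move=> [w [sw wD wc wz]]; case: w sw wD wc wz => [|i [|? ?]] //= _.
rewrite andbT => iD ic iz.
have [u [su uD uz]] := cover_cell k iz.
exists (i :: u); rewrite /= su iD; split=> //.
by case=> e; case: ic; rewrite e.
Qed.

(** By induction: the set is the image under [phi c] of the preceding one, together with the other
    first-level cells. *)
Lemma off_corner_connected c k : nice_corner c -> connected (off_corner c k.+1).
Proof.
move=> nc; have [cD sep _] := nc.
have n2 := natN_ge2 R N2.
have c1 : connected (off_corner c 1).
  rewrite -off_corner1; apply: connected_of_linked.
  - by move=> i; apply: cell_connected.
  - by move=> i; apply: cell_neq0.
  - move=> P PD P0 Pn; have [i [j [iP jD jP [y [z [Fy Fz e]]]]]] := linked_off_corner nc PD P0 Pn.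
    exists i, j; split=> //; exists (phi i y); split; first exact/cell1.
    by rewrite e; exact/cell1.
elim: k => [//|k IH]; rewrite off_cornerS //; apply: connectedU => //; last first.
  apply: connected_continuous_connected => //; apply: continuous_subspaceT.
  exact: phi_continuous.
(* The two parts meet at a contact of [c] with another digit [a]. Along some axis [c] has digit 0
   and [a] does not, so the contact has coordinate 1 inside the cell of [c] and avoids the corner
   subcell. *)
have [a [y [z [aD ac [Fy Fz e]]]]] := link_digit cD.
exists (phi c y); split; last first.
  exists [:: a]; rewrite /= aD; split=> //; first by case=> e'; rewrite e' eqxx in ac.
  by rewrite e; exact/cell1.
exists y => //; have [w [sw wD wy]] := cover k.+1 Fy.
exists w; split=> // we; have [f f0 fa] := sep a aD ac.
have y1 : co f y = 1.
  have [[h _]|[h _ _]|[_ -> _]] := touch_cases f Fy Fz e; move=> //; exfalso; nat_lia.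
move: wy; rewrite we /= => /cell_consE[p wp yE].
have pF : F p by apply: cell_sub wp; move: wD; rewrite we /= => /andP[].
rewrite yE in y1; have := cd_edge1 pF y1; rewrite f0; nat_lia.
Qed.

Lemma corner_fix_cell c k : c \in D -> cell (nseq k c) (fixpt R c).
Proof.
move=> cD; elim: k => [|k IH]; first by rewrite cell_nil; exact: fixpt_in.
by rewrite -(phi_fixpt R N2 c); exact/cell_phi.
Qed.

(** The class [[set i]] has only its own block to offer, and the deleted word [i c ... c] belongs to
    it. The other [|D| ^ k - 1] words of the block stay connected since [c] is a nice corner; this
    is the loss that the [- 1] of the theorem allows for. *)
Lemma tail_of_corner_pinch k x i j c y z : (0 < k)%N -> pinch [set i]%SET x -> j \in D -> j != i ->
  F y -> F z -> phi i y = phi j z -> nice_corner c -> fixpt R c = y -> long_tail k.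
Proof.
move=> k0 pI jD ji Fy Fz e nc cy.
have iI : i \in [set i]%SET by rewrite inE.
have jI : j \notin [set i]%SET by rewrite inE.
have [sg _] := pinch_single pI iI jD jI Fy Fz e; have sy := single_simple sg.
have [iD1 _ _ h] := pI; have iD : i \in D by rewrite -finset.sub1set.
have [cD _ _] := nc.
have cells : all (fun l => l \in D) (nseq k c) by rewrite all_nseq cD orbT.
have sq : size (i :: nseq k c) == k.+1 by rewrite /= size_nseq.
pose q := Tuple sq.
have qD : q \in words D k.+1 by rewrite in_words /= iD.
have hdw l (w : k.+1.-tuple (digit N)) : w \in headed k l ->
    exists u, [/\ size u = k, inD u & tval w = l :: u].
  rewrite inE in_words => /andP[wD /eqP wl]; exists (behead w); split.
  - by rewrite size_behead size_tuple.
  - by move: wD; rewrite {1}(tuple_eta w) /= => /andP[].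
  - by rewrite {1}(tuple_eta w) wl.
have hq : thead q = i by [].
have qh : q \in headed k i by rewrite inE qD hq eqxx.
have big : (1 < #|D| ^ k)%N.
  apply: leq_trans D2 _; rewrite -{1}(expn1 #|D|); apply: leq_pexp2l => //; exact: ltnW.
rewrite /long_tail.
apply: (@chi_cut k.+1 _ q (headed k i :\ q) (headed k j) (headed k i)) => //.
- nat_lia.
- by apply/fintype.subsetP => w; rewrite !in_setD1 => /andP[->]; rewrite inE => /andP[].
- apply/fintype.subsetP => w wj; rewrite in_setD1; move: (wj); rewrite inE => /andP[-> _].
  rewrite andbT; apply: contraTneq wj => ->; rewrite inE hq negb_and.
  by rewrite eq_sym in ji; rewrite (negPf ji) orbT.
- have -> : word_union (headed k i :\ q)%SET = phi i @` off_corner c k.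
    apply/seteqP; split=> p.
      move=> [w]; rewrite in_setD1 => /andP[wq /hdw[u [su uD wu]]].
      rewrite wu => /cell_consE[p' up' ->]; exists p' => //; exists u; split=> // uc.
      by case/eqP: wq; apply: val_inj; rewrite /= wu uc.
    move=> [p' [u [su uD uc up'] <-]].
    have siu : size (i :: u) == k.+1 by rewrite /= su.
    exists (Tuple siu); last exact/cell_phi.
    have hs : thead (Tuple siu) = i by [].
    rewrite !inE hs eqxx /= iD uD /= andbT.
    by apply/eqP => /(congr1 val) /= [].
  apply: connected_continuous_connected; last first.
    by apply: continuous_subspaceT; exact: phi_continuous.
  by case: (k) k0 => // k' _; exact: off_corner_connected.
- exact: headed_connected.
- exact: finset.subsetDl.
- move=> w; rewrite inE => /andP[_ /eqP wj]; rewrite inE wj negb_and.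
  by rewrite (negPf ji) orbT.
- move=> w u p wD uD wq uq wP uP wp up.
  have [t [st tD wt]] := hdw _ _ wP.
  rewrite wt in wp; have [y' ty' pE] := (iffLR (cell_consE i t p)) wp.
  have [b [t' [st' bD t'D ut]]] : exists b t', [/\ size t' = k, b \in D, inD t' & tval u = b :: t'].
    exists (thead u), (behead u); move: uD; rewrite in_words {1}(tuple_eta u) /= => /andP[-> ->].
    by split=> //; [rewrite size_behead size_tuple|rewrite {1}(tuple_eta u)].
  rewrite ut in up; have [z' tz' pE'] := (iffLR (cell_consE b t' p)) up.
  have bi : b \notin [set i]%SET.
    rewrite inE; apply: contra uP => /eqP bi; rewrite inE uD /=; apply/eqP.
    by move: ut; rewrite {1}(tuple_eta u) /= => -[-> _].
  have Fy' := cell_sub tD ty'; have Fz' := cell_sub t'D tz'.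
  have e' : phi i y' = phi b z' by rewrite -pE.
  have yy : y' = y.
    apply: (phi_inj N2 (i := i)); rewrite (h i b y' z') //.
    by rewrite (h i j y z).
  case/eqP: wq; apply: val_inj; rewrite /= wt; congr cons; apply: sy => //.
  + by rewrite st size_nseq.
  + by rewrite -yy.
  + by rewrite -cy; exact: corner_fix_cell.
- have := cardsD1 q (headed k i); rewrite qh card_headed // card_words => ->.
  by rewrite add1n subn1.
- by rewrite card_headed // card_words leq_subr.
Qed.

(** Two of the three other squares around the corner [y] are occupied, so one of [j1] and [j2]
    shares an edge with [i]. Exchanging axes and digits reduces to [nice_corner_of_contacts]. *)
Lemma nice_corner_of_three (I : {set digit N}) x i j1 j2 y z1 z2 : pinch I x -> i \in I ->
  j1 \in D -> j2 \in D -> j1 \notin I -> j2 \notin I -> j1 <> j2 ->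
  F y -> F z1 -> F z2 -> phi i y = phi j1 z1 -> phi i y = phi j2 z2 ->
  exists c, nice_corner c /\ fixpt R c = y.
Proof.
move=> pI iI j1D j2D j1I j2I j12 Fy Fz1 Fz2 e1 e2.
have [_ u1] := pinch_single pI iI j1D j1I Fy Fz1 e1.
have [_ u2] := pinch_single pI iI j2D j2I Fy Fz2 e2.
have ne1 : j1 <> i by move=> ji; rewrite ji iI in j1I.
have ne2 : j2 <> i by move=> ji; rewrite ji iI in j2I.
have [f [g [fg yf yg]]] := corner_frame ne1 ne2 j12 Fy Fz1 Fz2 e1 e2.
have gf : g.1 != f.1 by rewrite eq_sym.
have inj (a b : digit N) : cd f a = cd f b -> cd g a = cd g b -> a = b := cd_inj N2 fg.
have [[a1 b1]|[a1 b1]] := contact_type Fy Fz1 e1 yf;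
have [[a1' b1']|[a1' b1']] := contact_type Fy Fz1 e1 yg;
have [[a2 b2]|[a2 b2]] := contact_type Fy Fz2 e2 yf;
have [[a2' b2']|[a2' b2']] := contact_type Fy Fz2 e2 yg;
  try (by case: ne1; apply/esym/inj); try (by case: ne2; apply/esym/inj).
all: try (by case: j12; apply: inj; nat_lia).
all: first [ exact: (nice_corner_of_contacts fg yf yg Fy Fz1 Fz2 e1 e2 u1 u2)
           | exact: (nice_corner_of_contacts gf yg yf Fy Fz1 Fz2 e1 e2 u1 u2)
           | exact: (nice_corner_of_contacts fg yf yg Fy Fz2 Fz1 e2 e1 u2 u1)
           | exact: (nice_corner_of_contacts gf yg yf Fy Fz2 Fz1 e2 e1 u2 u1) ].
Qed.

(** Along the axis of contact the digits 0 and [N - 1] both occur, and the two digits differ by one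
    there, so [N = 2]. Then the fixed points of [i] and [j] form a contact, and by uniqueness [y] is
    the fixed point of [j]. *)
Lemma nice_corner_of_two (I : {set digit N}) x i j y z :
  pinch I x -> i \in I -> j \in D -> j \notin I ->
  F y -> F z -> phi i y = phi j z -> (forall l, l \in D -> l = i \/ l = j) ->
  exists c, nice_corner c /\ fixpt R c = y.
Proof.
move=> pI iI jD jI Fy Fz e two; have [_ u] := pinch_single pI iI jD jI Fy Fz e.
have [ID _ _ _] := pI; have iD := fintype.subsetP ID _ iI.
have ij : i <> j by move=> ij; rewrite -ij iI in jI.
have [f [cf yf zf]] : exists f, [/\ cd f i = (cd f j).+1, co f y = 0 & co f z = 1].
  have [f0 nf0] : exists f, cd f i <> cd f j.
    apply: contrapT => no; apply: ij.
    have c f : cd f i = cd f j by apply: contrapT => h; apply: no; exists f.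
    exact: (@cd_inj N N2 (true, false) (false, false)).
  have [[//]|[h h0 h1]|[h h1 h0]] := touch_cases f0 Fy Fz e; first by exists f0.
  exists (flip f0); rewrite !co_flip h1 h0 !cd_flip // subrr subr0; split=> //.
  have := cd_lt N2 f0 j; nat_lia.
have [p [y' [pD Fy' yE]]] := F_decomp Fy; have [q [z' [qD Fz' zE]]] := F_decomp Fz.
have fp : cd f p = 0%N by apply: (cd_edge0 Fy'); rewrite -yE.
have fq : cd f q = N.-1 by apply: (cd_edge1 Fz'); rewrite -zE.
have NE : N = 2%N /\ cd f j = 0%N.
  case: (two p pD) => pE; first by rewrite -pE fp in cf.
  case: (two q qD) => qE; last by exfalso; move: fq; rewrite qE -pE fp; nat_lia.
  move: fq; rewrite qE cf -pE fp; nat_lia.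
have [N2E fj] := NE.
have NR : N%:R - 1 = 1 :> R by rewrite N2E; lra.
have n1 := natN1_neq0 R N2.
have yj : y = fixpt R j.
  apply/esym/(u _ (fixpt R i)); [exact: fixpt_in|exact: fixpt_in|].
  by apply: (@touch_intro (true, false) (false, false)) => //; rewrite !co_fixpt // NR !divr1 addrC.
exists j; split=> //; split=> //.
  move=> a aD aj; exists f => //; case: (two a aD) => aE; first by rewrite aE cf.
  by rewrite aE eqxx in aj.
move=> a b aD bD aj bj ab; case/eqP: ab.
by case: (two a aD) aj => [->|->]; rewrite ?eqxx //; case: (two b bD) bj => [->|->]; rewrite ?eqxx.
Qed.

(* Four cells around a common node: the carpet then contains the four corners of the
   unit square, so two cells sharing an edge meet in more than one point. *)
Lemma no_four (I : {set digit N}) x i1 i2 j1 j2 : pinch I x -> i1 \in I -> i2 \in I -> i1 <> i2 ->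
  j1 \in D -> j2 \in D -> j1 \notin I -> j2 \notin I -> j1 <> j2 ->
  holds x i1 -> holds x i2 -> holds x j1 -> holds x j2 -> False.
Proof.
move=> pI i1I i2I i12 j1D j2D j1I j2I j12 [y [Fy yE]] [y2 [Fy2 y2E]] [z1 [Fz1 z1E]] [z2 [Fz2 z2E]].
have e1 : phi i1 y = phi j1 z1 by rewrite -yE.
have e2 : phi i1 y = phi j2 z2 by rewrite -yE.
have e3 : phi i1 y = phi i2 y2 by rewrite -yE.
have [_ u1] := pinch_single pI i1I j1D j1I Fy Fz1 e1.
have [_ u2] := pinch_single pI i1I j2D j2I Fy Fz2 e2.
have ne1 : j1 <> i1 by move=> ji; rewrite ji i1I in j1I.
have ne2 : j2 <> i1 by move=> ji; rewrite ji i1I in j2I.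
have n31 : j1 <> i2 by move=> ji; rewrite ji i2I in j1I.
have n32 : j2 <> i2 by move=> ji; rewrite ji i2I in j2I.
have [f [g [fg yf yg]]] := corner_frame ne1 ne2 j12 Fy Fz1 Fz2 e1 e2.
have gf : g.1 != f.1 by rewrite eq_sym.
have inj (a b : digit N) : cd f a = cd f b -> cd g a = cd g b -> a = b := cd_inj N2 fg.
have clash (h h' : frame) (j : digit N) z p p' :
    h.1 != h'.1 -> co h y = 0 -> co h' y = 0 -> F p -> F p' ->
    phi i1 y = phi j z -> (forall y' z', F y' -> F z' -> phi i1 y' = phi j z' -> y' = y) ->
    co h z = 1 -> co h' z = 0 -> co h p = 0 -> co h' p = 1 -> co h p' = 1 -> co h' p' = 1 -> False.
  move=> hh yh yh' Fp Fp' e u zh zh' ph ph' p'h p'h'.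
  have t := touchE h e; have t' := touchE h' e.
  have py : p = y by apply: (u p p') => //; apply: (touch_intro hh); lra.
  by move/eqP: ph'; rewrite py yh' eq_sym oner_eq0.
have type (l : digit N) w : F w -> phi i1 y = phi l w -> exists a b : bool,
    [/\ cd f i1 = (a + cd f l)%N, cd g i1 = (b + cd g l)%N, co f w = a%:R & co g w = b%:R].
  move=> Fw e; have [[h1 h2]|[h1 h2]] := contact_type Fy Fw e yf;
  have [[h3 h4]|[h3 h4]] := contact_type Fy Fw e yg.
  - by exists false, false.
  - by exists false, true.
  - by exists true, false.
  - by exists true, true.
have [a1 [b1 [c1 c1' z1f z1g]]] := type _ _ Fz1 e1.
have [a2 [b2 [c2 c2' z2f z2g]]] := type _ _ Fz2 e2.
have [a3 [b3 [c3 c3' y2f y2g]]] := type _ _ Fy2 e3.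
(* The pair of booleans is the position of a cell relative to that of [i1]; the four digits occupy
   four different positions. *)
have dif (l l' : digit N) (a b a' b' : bool) : l <> l' ->
    cd f i1 = (a + cd f l)%N -> cd g i1 = (b + cd g l)%N ->
    cd f i1 = (a' + cd f l')%N -> cd g i1 = (b' + cd g l')%N -> (a, b) != (a', b').
  move=> ll' h1 h2 h3 h4; apply/eqP => -[ea eb]; apply: ll'; subst a' b'.
  by apply: inj; [move: h3; rewrite h1 => /addnI|move: h4; rewrite h2 => /addnI].
have := dif _ _ a1 b1 false false ne1 c1 c1' erefl erefl.
have := dif _ _ a2 b2 false false ne2 c2 c2' erefl erefl.
have i21 : i2 <> i1 by move=> ii; apply: i12.
have := dif _ _ a3 b3 false false i21 c3 c3' erefl erefl.
have := dif _ _ a1 b1 a2 b2 j12 c1 c1' c2 c2'.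
have := dif _ _ a1 b1 a3 b3 n31 c1 c1' c3 c3'.
have := dif _ _ a2 b2 a3 b3 n32 c2 c2' c3 c3'.
clear c1 c1' c2 c2' c3 c3' dif type.
case: a1 z1f; case: b1 z1g => // z1g z1f; case: a2 z2f; case: b2 z2g => // z2g z2f;
  case: a3 y2f; case: b3 y2g => // y2g y2f _ _ _ _ _ _.
all: first [ exact: (clash f g j1 z1 z2 y2) | exact: (clash f g j1 z1 y2 z2)
           | exact: (clash g f j1 z1 z2 y2) | exact: (clash g f j1 z1 y2 z2)
           | exact: (clash f g j2 z2 z1 y2) | exact: (clash f g j2 z2 y2 z1)
           | exact: (clash g f j2 z2 z1 y2) | exact: (clash g f j2 z2 y2 z1) ].
Qed.

Lemma unique_holder_dec (I : {set digit N}) x i :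
  (forall l, l \in I -> holds x l -> l = i) \/ exists l, [/\ l \in I, holds x l & l <> i].
Proof.
have [h|no] := pselect (exists l, [/\ l \in I, holds x l & l <> i]); first by right.
by left=> l lI lx; apply: contrapT => li; apply: no; exists l.
Qed.

Lemma eq_set1_dec (I : {set digit N}) i : i \in I ->
  I = [set i]%SET \/ exists2 l, l \in I & l != i.
Proof.
move=> iI; have [h|no] := pselect (exists2 l, l \in I & l != i); first by right.
left; apply/setP => l; rewrite inE; have [->|li] := eqVneq l i; first exact: iI.
by apply/negP => lI; apply: no; exists l.
Qed.

(** A class with a single digit at [x] and a further digit elsewhere allows [tail_of_unique_holder].
    A class of one digit needs a nice corner, which exists if the other class has two digits at [x]
    or consists of one digit as well. Two digits of each class at [x] are excluded by [no_four]. *)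
Lemma pinch_tail k (I : {set digit N}) x : (0 < k)%N -> pinch I x -> long_tail k.
Proof.
move=> k0 pI; have [i [j [y [z [iI jD jI [Fy Fz e]]]]]] := pinch_contact pI.
have [ID _ _ h] := pI; have iD := fintype.subsetP ID _ iI.
have xE : x = phi i y by rewrite (h i j y z).
have xE' : x = phi j z by rewrite -e.
have pJ := pinch_compl pI; set J := (D :\: I)%SET in pJ.
have jJ : j \in J by rewrite inE jI jD.
have iJ : i \notin J by rewrite inE iI.
have inJ l : l \in J -> l \in D /\ l \notin I by rewrite inE => /andP[].
have notJ l : l \in I -> l \notin J by move=> lI; rewrite inE lI.
have [uJ|[j1 [/inJ[j1D j1I] [z1 [Fz1 z1E]] j1j]]] := unique_holder_dec J x j.
  have [J1|[j2 j2J j2j]] := eq_set1_dec jJ; last first.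
    exact: (tail_of_unique_holder k pJ jJ iD iJ Fz Fy (esym e) uJ j2J j2j).
  have [uI|[i1 [i1I [y1 [Fy1 y1E]] i1i]]] := unique_holder_dec I x i.
    have [I1|[i2 i2I i2i]] := eq_set1_dec iI; last first.
      exact: (tail_of_unique_holder k pI iI jD jI Fy Fz e uI i2I i2i).
    have [|c [nc cy]] := nice_corner_of_two pI iI jD jI Fy Fz e.
      move=> l lD; have [|lI] := boolP (l \in I); first by rewrite I1 inE => /eqP; left.
      by right; apply/eqP; have : l \in J by [rewrite inE lI]; rewrite J1 inE.
    rewrite I1 in pI.
    apply: (tail_of_corner_pinch k0 pI jD _ Fy Fz e nc cy).
    by apply: contraNneq jI => ->.
  have i1D := fintype.subsetP ID _ i1I.
  have ii1 : i <> i1 by move=> ii; apply: i1i.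
  have [|c [nc cz]] := nice_corner_of_three pJ jJ iD i1D iJ (notJ _ i1I) ii1 Fz Fy Fy1 (esym e).
    by rewrite -xE'.
  rewrite J1 in pJ.
  apply: (tail_of_corner_pinch k0 pJ iD _ Fz Fy (esym e) nc cz).
  by apply: contraNneq jI => <-.
have [uI|[i1 [i1I [y1 [Fy1 y1E]] i1i]]] := unique_holder_dec I x i; last first.
  exfalso; apply: (no_four pI iI i1I _ jD j1D jI j1I); first by move=> ii; apply: i1i.
  - by move=> jj; apply: j1j.
  - by exists y.
  - by exists y1.
  - by exists z.
  - by exists z1.
have [I1|[i2 i2I i2i]] := eq_set1_dec iI; last first.
  exact: (tail_of_unique_holder k pI iI jD jI Fy Fz e uI i2I i2i).
have jj1 : j <> j1 by move=> jj; apply: j1j.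
have [|c [nc cy]] := nice_corner_of_three pI iI jD j1D jI j1I jj1 Fy Fz Fz1 e.
  by rewrite -xE.
rewrite I1 in pI.
apply: (tail_of_corner_pinch k0 pI jD _ Fy Fz e nc cy).
by apply: contraNneq jI => ->.
Qed.

Lemma long_tail_of_cut_point k : (0 < k)%N -> (exists x, cut_point F x) -> long_tail k.
Proof.
move=> k0 [x /cut_separation[A sA]].
have [[I [p pI]]|nf] := pselect fragile; first exact: (pinch_tail k0 pI).
have [x' [A' [sA' sx']]] := simple_separation nf sA.
exact: nonfragile_tail nf sA' sx'.
Qed.

(** * From cut vertices to cut points *)

(** The number with the base [N] digits of [w] along [f], that is, the position of the cell in the
    grid of its level. *)
Fixpoint code f (w : seq (digit N)) : nat :=
  if w is i :: t then (cd f i * N ^ size t + code f t)%N else 0%N.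

Lemma code_lt f w : (code f w < N ^ size w)%N.
Proof.
elim: w => [|i w IH] //=; rewrite expnS.
have := cd_lt N2 f i => h; apply: (@leq_trans ((cd f i).+1 * N ^ size w)).
  by rewrite mulSn addnC ltn_add2r.
by rewrite leq_mul2r h orbT.
Qed.

Lemma code_inj f g (w u : seq (digit N)) : f.1 != g.1 -> size w = size u ->
  code f w = code f u -> code g w = code g u -> w = u.
Proof.
move=> fg; elim: w u => [|i w IH] [|j u] //= [sz] cf cg.
have N0 : (0 < N ^ size u)%N by rewrite expn_gt0; lia.
have digit_split h : (cd h i * N ^ size w + code h w = cd h j * N ^ size u + code h u)%N ->
    cd h i = cd h j /\ code h w = code h u.
  move=> e; have := code_lt h w; have := code_lt h u; rewrite sz in e * => lu lw.
  have ed : cd h i = cd h j.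
    by move/(congr1 (fun c => c %/ N ^ size u)%N): e; rewrite !divnMDl // !divn_small // !addn0.
  by split=> //; move: e; rewrite ed => /addnI.
have [a b] := digit_split f cf; have [a' b'] := digit_split g cg.
by rewrite (cd_inj N2 fg a a') (IH u).
Qed.

Lemma cell_code f w z : inD w -> cell w z ->
  exists y, F y /\ co f z * N%:R ^+ size w = co f y + (code f w)%:R.
Proof.
elim: w z => [|i w IH] z /=.
  by rewrite cell_nil => _ Fz; exists z; rewrite expr0 mulr1 addr0.
move=> /andP[iD wD] /cell_consE[z' wz ->]; have [y [Fy e]] := IH z' wD wz.
exists y; split=> //; have n0 := natN_neq0 R N2.
rewrite coE // exprS mulrA divfK // mulrDl e natrD natrM natrX; ring.
Qed.

(* Two codes along one axis of cells through the same point differ by at most one,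
   so parity separates them. *)
Lemma card_cells_at x m : (#|[set p in words D m | `[< cell p x >]]%SET| <= 4)%N.
Proof.
set W := [set p in _ | _]%SET.
pose par (p : m.-tuple (digit N)) := (odd (code (true, false) p), odd (code (false, false) p)).
have parI : {in W &, injective par}.
  move=> p q; rewrite !inE => /andP[pD /asboolP px] /andP[qD /asboolP qx] [e1 e2].
  apply: val_inj => /=; have szE : size p = size q by rewrite !size_tuple.
  have same f : odd (code f p) = odd (code f q) -> code f p = code f q.
    move=> oe; have [y [Fy ey]] := cell_code f pD px.
    have [z [Fz ez]] := cell_code f qD qx; rewrite szE ez in ey.
    case/(touch1 (F01 f Fz) (F01 f Fy)): ey => [[-> //]|[h _ _]|[h _ _]].
      by move: oe; rewrite h /=; case: odd.
    by move: oe; rewrite h /=; case: odd.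
  by apply: (@code_inj (true, false) (false, false)) => //; apply: same.
rewrite -(card_in_imset parI); apply: leq_trans (max_card _) _.
by rewrite card_prod card_bool.
Qed.

Lemma card_prefixed m (j : nat) (C : {set (m + j).-tuple (digit N)}) (L : seq (seq (digit N))) :
  C \subset words D (m + j) -> (forall w, w \in C -> take m w \in L) ->
  (#|C| <= size L * #|D| ^ j)%N.
Proof.
move=> CD CL.
pose s := [seq p ++ u | p <- L, u <- [seq val u | u <- enum (words D j)]].
have -> : (size L * #|D| ^ j = size s)%N by rewrite size_allpairs size_map -cardE card_words.
rewrite cardE -(size_map val); apply: uniq_leq_size.
  by rewrite map_inj_uniq ?enum_uniq //; exact: val_inj.
move=> t /mapP[w]; rewrite mem_enum => wC -> {t}.
apply/allpairsP; exists (take m w, drop m w); split=> //=; last by rewrite cat_take_drop.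
  exact: CL.
have sd : size (drop m w) == j by rewrite size_drop size_tuple addKn.
apply/mapP; exists (Tuple sd) => //; rewrite mem_enum in_words /=.
have := fintype.subsetP CD _ wC; rewrite in_words -{1}(cat_take_drop m w) all_cat.
by case/andP.
Qed.

Definition word K (w : seq (digit N)) := size w = K /\ inD w.

(* One side [C] of the graph of level [K] once the vertex [v] has been removed. *)
Definition side K (v : seq (digit N)) (C : seq (digit N) -> Prop) :=
  (forall w, C w -> word K w /\ w <> v) /\
  forall w u z, C w -> word K u -> u <> v -> cell w z -> cell u z -> C u.

(** The cell of [q] is connected and the word [v] does not lie in it, so the words of length [K] in
    it are all on one side. *)
Lemma side_prefix K v C q w u : side K v C -> inD q -> take (size q) v <> q ->
  C w -> take (size q) w = q -> word K u -> take (size q) u = q -> C u.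
Proof.
move=> [CK stab] qD vq Cw wq uK uq.
pose S : {set K.-tuple (digit N)} := [set t in words D K | take (size q) t == q]%SET.
pose P : {set K.-tuple (digit N)} := [set t in S | `[< C t >]]%SET.
have [[sw wD] _] := CK _ Cw; have [su uD] := uK.
have qK : (size q <= K)%N.
  by rewrite -sw -[X in (X <= _)%N](congr1 size wq) size_take; case: ltnP => // /ltnW.
have tupS t (st : size t = K) : inD t -> take (size q) t = q -> Tuple (introT eqP st) \in S.
  by move=> tD tq; rewrite inE in_words /= tD tq eqxx.
have uS : union (fun t : K.-tuple (digit N) => cell t) S = cell q.
  apply/seteqP; split=> z.
    move=> [t]; rewrite inE in_words => /andP[tD /eqP tq].
    move: tD; rewrite -(cat_take_drop (size q) t) tq all_cat => /andP[_ dD].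
    exact: cell_prefix.
  move=> qz; have [t [st tD tz]] := cover_cell (K - size q) qz.
  have sqt : size (q ++ t) = K by rewrite size_cat st subnKC.
  exists (Tuple (introT eqP sqt)) => //; apply: tupS; rewrite ?all_cat ?qD //.
  by rewrite take_size_cat.
have [PS|PnS] := eqVneq P S.
  have := tupS u su uD uq; rewrite -PS inE => /andP[_ /asboolP]; exact.
have [||||a [b [aP bS bP [z [az bz]]]]] := @linked_of_connected _ _
  (fun t : K.-tuple (digit N) => cell t) S P (fun t => @cell_closed t) (fun t => cell_neq0 t).
- by rewrite uS; exact: cell_connected.
- by apply/fintype.subsetP => t; rewrite inE => /andP[].
- apply/finset.set0Pn; exists (Tuple (introT eqP sw)); rewrite inE tupS //=.
  exact/asboolP.
- exact: PnS.
case/negP: bP; rewrite inE bS /=; apply/asboolP.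
move: aP; rewrite inE => /andP[_ /asboolP Ca].
move: bS; rewrite inE in_words => /andP[bD /eqP bq].
apply: (stab _ _ _ Ca _ _ az bz); first by split; rewrite ?size_tuple.
by move=> bv; apply: vq; rewrite -bv.
Qed.

(** Four prefixes of length 4 account for at most [4 * |D| ^ j] words of length [4 + j], fewer than
    [|D| ^ (3 + j) - 1] because [|D| ^ 3 >= 8]. So neither component is confined to four cells of
    level 4. *)
Lemma side_of_long_tail (j : nat) : long_tail (4 + j).-1 -> (2 < #|D| ^ (4 + j).-1)%N ->
  exists v C, [/\ word (4 + j) v, side (4 + j) v C,
    forall L : seq (seq (digit N)), (size L <= 4)%N ->
      exists2 w, C w & take 4 w \notin L &
    forall L : seq (seq (digit N)), (size L <= 4)%N ->
      exists w, [/\ word (4 + j) w, w <> v, ~ C w & take 4 w \notin L]].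
Proof.
rewrite /long_tail -[(4 + j).-1.+1]/(4 + j)%N => lt big.
have m0 : (0 < #|D| ^ (4 + j).-1 - 1)%N by lia.
have [v [x1 [x2 [vD x1V x2V x12 [c1 c2]]]]] := chi_witness m0 lt.
pose K := (4 + j)%N; pose e := restr_rel (words D K :\ v)%SET (hata_rel F K).
pose C (w : seq (digit N)) := exists t : K.-tuple (digit N),
  [/\ val t = w, t \in (words D K :\ v)%SET & connect e x1 t].
have CE (t : K.-tuple (digit N)) : C t -> t \in component (words D K :\ v) (hata_rel F K) x1.
  by move=> [t' [/val_inj -> tV ct]]; rewrite /component inE tV.
have small_set (x0 : K.-tuple (digit N)) (L : seq (seq (digit N))) : (size L <= 4)%N ->
    (#|D| ^ (4 + j).-1 - 1 <= #|component (words D K :\ v) (hata_rel F K) x0|)%N ->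
    exists2 t, t \in component (words D K :\ v) (hata_rel F K) x0 & take 4 (val t) \notin L.
  move=> sL cc; apply: contrapT => no.
  have : (#|component (words D K :\ v) (hata_rel F K) x0| <= size L * #|D| ^ j)%N.
    apply: (@card_prefixed 4 j).
      by apply/fintype.subsetP => t; rewrite /component !inE => /andP[/andP[_ ->]].
    by move=> t tC; apply: contraT => tL; case: no; exists t.
  move=> le2; move: (leq_trans cc le2); rewrite leqNgt => /negP; apply.
  have d0 : (0 < #|D| ^ j)%N by rewrite expn_gt0; lia.
  have e3 : (#|D| ^ (4 + j).-1 = #|D| ^ 3 * #|D| ^ j)%N by rewrite -expnD.
  have e8 : (8 <= #|D| ^ 3)%N by rewrite (@leq_exp2r 2 _ 3).
  have : (size L * #|D| ^ j <= 4 * #|D| ^ j)%N by rewrite leq_mul2r sL orbT.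
  have : (8 * #|D| ^ j <= #|D| ^ 3 * #|D| ^ j)%N by rewrite leq_mul2r e8 orbT.
  rewrite -e3 => h1 h2; lia.
exists (val v), C; split.
- by split; [rewrite size_tuple|rewrite -in_words].
- split.
    move=> w [t [<- tV _]]; move: tV; rewrite !inE => /andP[tv tD].
    split; first by split; rewrite ?size_tuple.
    by move=> /val_inj tE; case/eqP: tv.
  move=> w u z [t [<- tV ct]] [su uD] uv tz uz.
  have uV : Tuple (introT eqP su) \in (words D K :\ v)%SET.
    rewrite !inE /= uD andbT; apply/eqP => /(congr1 val); exact: uv.
  exists (Tuple (introT eqP su)); split=> //.
  have [->|ne] := eqVneq (Tuple (introT eqP su)) t; first exact: ct.
  apply: connect_trans ct (connect1 _); apply/and3P; split=> //.
  by rewrite /hata_rel /= eq_sym ne /=; apply/asboolP; exists z.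
- move=> L sL; have [t tC tL] := small_set x1 L sL c1.
  exists (val t) => //; exists t; split=> //; move: tC; rewrite /component inE; by case/andP.
- move=> L sL; have [t tC tL] := small_set x2 L sL c2.
  move: tC; rewrite /component inE => /andP[tV ct].
  exists (val t); split=> //.
  + by move: tV; rewrite !inE => /andP[_ tD]; split; rewrite ?size_tuple.
  + by move: tV; rewrite !inE => /andP[tv _] /val_inj tE; case/eqP: tv.
  + move=> /CE; rewrite /component inE => /andP[_ ct1]; case/negP: x12.
    apply: connect_trans ct1 _; rewrite (sym_connect_sym _ t) //.
    move=> a b; rewrite /restr_rel /= andbCA; congr [&& _, _ & _].
    rewrite /hata_rel /= eq_sym; congr andb.
    by apply/asboolP/asboolP => -[z [? ?]]; exists z.
Qed.

(** The cells of level [m] that miss [z] are finitely many and closed. *)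
Lemma level_neighbourhood m z : exists W, [/\ open W, W z &
  forall y w, W y -> word m w -> cell w y -> cell w z].
Proof.
pose S : {set m.-tuple (digit N)} := [set p in words D m | `[< ~ cell p z >]]%SET.
exists (~` word_union S); split.
- by apply: closed_openC; apply: union_closed => p; exact: cell_closed.
- by move=> [p]; rewrite inE => /andP[_ /asboolP].
- move=> y w Wy [sw wD] wy; apply: contrapT => nwz; apply: Wy.
  exists (Tuple (introT eqP sw)) => //; rewrite inE in_words /= wD /=; exact/asboolP.
Qed.

Lemma word_take m K w : word K w -> (m <= K)%N -> word m (take m w).
Proof.
move=> [sw wD] mK; split; first by rewrite size_takel // sw.
by move: wD; rewrite -{1}(cat_take_drop m w) all_cat => /andP[].
Qed.

Lemma cell_take m K w z : word K w -> cell w z -> cell (take m w) z.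
Proof.
move=> [sw wD]; rewrite -{1}(cat_take_drop m w); apply: cell_prefix.
by move: wD; rewrite -{1}(cat_take_drop m w) all_cat => /andP[].
Qed.

Lemma extend_word m K q z : word m q -> (m <= K)%N -> cell q z ->
  exists w, [/\ word K w, take m w = q & cell w z].
Proof.
move=> [sq qD] mK qz; have [u [su uD uz]] := cover_cell (K - m) qz.
exists (q ++ u); split=> //; last by rewrite -sq take_size_cat.
by split; [rewrite size_cat sq su subnKC|rewrite all_cat qD].
Qed.

(** Some word with the prefix of [u] has [z] in its cell and so joins the side; [side_prefix]
    carries this over to [u]. *)
Lemma side_spreads m K v (C : seq (digit N) -> Prop) w z u : (m <= K)%N -> side K v C ->
  C w -> cell w z -> word K u -> cell (take m u) z -> take m v <> take m u -> C u.
Proof.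
move=> mK sC Cw wz uK uz vu; have [sq qD] := word_take uK mK.
have [t [tK tq tz]] := extend_word (word_take uK mK) mK uz.
have Ct : C t.
  have [_ stab] := sC; apply: (stab w t z) => // tv; apply: vu; rewrite -tv; exact: tq.
by apply: (@side_prefix K v C (take m u) t u); rewrite ?sq.
Qed.

Lemma cut_point_of_long_tail : (forall k, (0 < k)%N -> long_tail k) -> exists x, cut_point F x.
Proof.
move=> lt.
have big (j : nat) : (2 < #|D| ^ (4 + j).-1)%N.
  apply: (@leq_trans (2 ^ 2)) => //; apply: (@leq_trans (#|D| ^ 2)); first by rewrite leq_exp2r.
  by apply: leq_pexp2l; rewrite ?(ltnW D2) //; lia.
have [f fP] : {f : nat -> seq (digit N) * (seq (digit N) -> Prop) & forall j : nat,
    [/\ word (4 + j) (f j).1, side (4 + j) (f j).1 (f j).2,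
    forall L : seq (seq (digit N)), (size L <= 4)%N ->
      exists2 w, (f j).2 w & take 4 w \notin L &
    forall L : seq (seq (digit N)), (size L <= 4)%N ->
      exists w, [/\ word (4 + j) w, w <> (f j).1, ~ (f j).2 w & take 4 w \notin L]]}.
  apply: (choice (P := fun (j : nat) (p : seq (digit N) * (seq (digit N) -> Prop)) =>
    [/\ word (4 + j) p.1, side (4 + j) p.1 p.2,
    forall L : seq (seq (digit N)), (size L <= 4)%N ->
      exists2 w, p.2 w & take 4 w \notin L &
    forall L : seq (seq (digit N)), (size L <= 4)%N ->
      exists w, [/\ word (4 + j) w, w <> p.1, ~ p.2 w & take 4 w \notin L]])).
  move=> j; have [||v [C h]] := @side_of_long_tail j; first by apply: lt.
    exact: big.
  by exists (v, C).
pose v (j : nat) := (f j).1; pose C (j : nat) := (f j).2.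
have vK (j : nat) : word (4 + j) (v j) by case: (fP j).
have sC (j : nat) : side (4 + j) (v j) (C j) by case: (fP j).
have [pt ptv] : {pt : nat -> R * R & forall j : nat, cell (v j) (pt j)}.
  exact: (choice (fun j : nat => cell_neq0 (v j))).
have [U [UU oU]] := @ultraFilterLemma nat \oo _.
have [x [Fx ptx]] : exists x, F x /\ pt @ U --> x.
  have [cF _] := gscF; rewrite compact_ultra in cF.
  have [|x [Fx ptx]] := cF (pt @ U) (fmap_ultra pt UU); last by exists x.
  by apply: (@filterE _ U) => j; exact: (cell_sub (vK j).2 (ptv j)).
have Uge m : U [set j : nat | (m <= j)%N] by apply: oU; exists m.
(* The points [pt j] converge to [x], so for almost all [j] the level [m] cell of [v j] contains
   [x]. *)
have near_x m : U [set j : nat | (m <= j)%N /\ cell (take m (v j)) x].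
  have [W [oW Wx hW]] := level_neighbourhood m x.
  have UW : U (pt @^-1` W) by apply: ptx; apply: open_nbhs_nbhs; split.
  apply: filterS (filterI (Uge m) UW) => j [mj Wj]; split=> //.
  by apply: hW Wj (word_take (vK j) (leq_trans mj (leq_addl 4 j))) (cell_take m (vK j) (ptv j)).
pose A_ (j : nat) : set (R * R) := [set y | exists w, C j w /\ cell w y].
pose A : set (R * R) := [set y | U [set j : nat | A_ j y]].
exists x; split=> // con.
(* At a level [m] that separates [z] from [x], the cells at [z] are not those of [v j]. Each of them
   is on one side, and those through a point close to [z] also contain [z]. *)
have loc z : (F `\ x) z -> exists W, [/\ open W, W z &
    forall y, (F `\ x) y -> W y -> (A z <-> A y)].
  move=> [Fz zx]; have xz : x <> z by move=> e; apply: zx.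
  have [m sep] := separating_level xz.
  have [W [oW Wz hW]] := level_neighbourhood m z.
  exists W; split=> // y [Fy _] Wy.
  have ok (j : nat) : (m <= j)%N -> cell (take m (v j)) x -> A_ j z <-> A_ j y.
    move=> mj vx; have mK : (m <= 4 + j)%N by lia.
    have vne w p : word (4 + j) w -> cell (take m w) z -> take m (v j) <> take m w.
      move=> wK wz e; have [sq qD] := word_take wK mK.
      by apply: (sep (take m w)) => //; rewrite -e.
    split=> -[w [Cw wp]].
      have [u [su uD uy]] := cover (4 + j) Fy.
      have uK : word (4 + j) u by [].
      have uz : cell (take m u) z.
        by apply: hW Wy (word_take uK mK) (cell_take m uK uy).
      by exists u; split=> //; apply: (side_spreads mK (sC j) Cw wp uK uz); exact: vne.
    have [wK _] := (sC j).1 w Cw.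
    have wz : cell (take m w) z by apply: hW Wy (word_take wK mK) (cell_take m wK wp).
    have [t [tK tq tz]] := extend_word (word_take wK mK) mK wz.
    exists t; split=> //; apply: (side_spreads mK (sC j) Cw wp tK).
      by rewrite tq; exact: (cell_take m wK wp).
    by rewrite tq; exact: vne.
  by split=> hA; apply: filterS (filterI (near_x m) hA) => j [[mj vx]] /(ok j mj vx).
pose L : seq (seq (digit N)) :=
  [seq val p | p <- enum [set p in words D 4 | `[< cell p x >]]%SET].
have L4 : (size L <= 4)%N by rewrite size_map -cardE card_cells_at.
have inL q : word 4 q -> cell q x -> q \in L.
  move=> [sq qD] qx; apply/mapP; exists (Tuple (introT eqP sq)) => //.
  by rewrite mem_enum inE in_words /= qD; apply/asboolP.
(* There are finitely many words of length 4, so one prefix [q] away from [x] serves for almost all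
   [j]. *)
have pick (P : nat -> seq (digit N) -> Prop) :
    (forall j : nat, exists w, [/\ word (4 + j) w, P j w & take 4 w \notin L]) ->
    exists q, [/\ word 4 q, ~ cell q x &
      U [set j : nat | exists w, [/\ word (4 + j) w, P j w & take 4 w = q]]].
  move=> hP; have [w wP] := choice hP.
  have wK (j : nat) : word (4 + j) (w j) by case: (wP j).
  have st (j : nat) : size (take 4 (w j)) == 4%N.
    by apply/eqP; have [] := word_take (wK j) (leq_addr j 4).
  have [q Uq] := ultra_pigeonhole (fun j : nat => Tuple (st j)) UU.
  have [j /(congr1 val) /= jq] := filter_ex Uq.
  have qK : word 4 q by rewrite -jq; apply: word_take (wK j) (leq_addr j 4).
  exists q; split=> //.
    by move/(inL _ qK); rewrite -jq; have [_ _ /negP] := wP j.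
  apply: filterS Uq => l /(congr1 val) /= lq; exists (w l); split=> //.
  by case: (wP l).
have [q1 [q1K q1x U1]] : exists q, [/\ word 4 q, ~ cell q x &
    U [set j : nat | exists w, [/\ word (4 + j) w, C j w & take 4 w = q]]].
  apply: pick => j; have [_ _ /(_ L L4)[w Cw wL] _] := fP j.
  by exists w; split=> //; have [] := (sC j).1 w Cw.
have [q2 [q2K q2x U2]] : exists q, [/\ word 4 q, ~ cell q x &
    U [set j : nat | exists w, [/\ word (4 + j) w, ~ C j w & take 4 w = q]]].
  by apply: pick => j; have [_ _ _ /(_ L L4)[w [wK _ nCw wL]]] := fP j; exists w.
have [z1 q1z] := cell_neq0 q1; have [z2 q2z] := cell_neq0 q2.
have inX q z : word 4 q -> ~ cell q x -> cell q z -> (F `\ x) z.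
  by move=> [_ qD] qx qz; split; [exact: cell_sub qz|move=> zx; apply: qx; rewrite -zx].
have vq q (j : nat) : ~ cell q x -> cell (take 4 (v j)) x -> take 4 (v j) <> q.
  by move=> qx vx e; apply: qx; rewrite -e.
have A1 : A z1.
  apply: filterS (filterI (near_x 4) U1) => j [[_ vx] [w [wK Cw wq]]].
  have [t [tK tq tz]] := extend_word q1K (leq_addr j 4) q1z.
  exists t; split=> //; have sq1 := q1K.1.
  apply: (@side_prefix _ _ _ q1 w t (sC j)); rewrite ?sq1 //; [exact: q1K.2|exact: vq].
have A2 : A z2.
  exact: (connected_locally_constant con loc (inX _ _ q1K q1x q1z) (inX _ _ q2K q2x q2z) A1).
(* For some [j] the point [z2] is covered by the side [C j], although a word in the cell of [q2] is
   off it; [side_spreads] excludes this. *)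
have [j [[[_ vx] [w [wK nCw wq]]] [u [Cu uz]]]] := filter_ex (filterI (filterI (near_x 4) U2) A2).
apply: nCw; apply: (side_spreads (leq_addr j 4) (sC j) Cu uz wK); rewrite wq //.
exact: vq.
Qed.

End Carpet.

Theorem mainTheorem1 (R : realType) (N : nat) (D : {set digit N})
    (F : set (R * R)) :
  (2 <= N)%N -> (1 < #|D|)%N -> (#|D| < N ^ 2)%N ->
  is_GSC D F -> connected F ->
  ((exists x, cut_point F x) <->
   (forall k : nat, (2 <= k)%N ->
      (#|D| ^ k.-1 - 1 <= chi (words D k) (hata_rel F k))%N)).
Proof.
move=> N2 D2 _ gscF conF; split=> [cut [|k] // k2|tails].
  exact: (long_tail_of_cut_point N2 gscF D2 conF).
by apply: (cut_point_of_long_tail N2 gscF D2 conF) => k k0; exact: (tails k.+1).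
Qed.
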